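(* Let $G$ be a graph with $n$ vertices, $m$ edges and degree sequence $(d(v_1),\dots,d(v_n))$, and let $\beta,\gamma$ be real numbers. For a hook partition $(k,1^{n-k})$ of $n$ write $$\operatorname{Imm}_{(k,1^{n-k})}(xI-\beta D(G)-\gamma A(G))=\sum_{r=0}^n(-1)^r c_r\,x^{n-r},\qquad c_r=c_{(k,1^{n-k}),r}(\beta D(G)+\gamma A(G)).$$ Then $$c_0=\binom{n-1}{k-1},\qquad c_1=\beta F_1(G)\binom{n-1}{k-1}=2m\beta\binom{n-1}{k-1},$$ $$c_2=\beta^2F_2(G)\binom{n-1}{k-1}+\frac{(2k-n-1)m\gamma^2}{k-1}\binom{n-2}{k-2}\quad(n\ge3),$$ $$c_3=\beta^3F_3(G)\binom{n-1}{k-1}+\frac{(2k-n-1)\beta\gamma^2\mathcal{M}_3^1(G)}{k-1}\binom{n-2}{k-2}+2|\mathscr{C}_3(G)|\gamma^3\left[\binom{n-4}{k-4}-\binom{n-4}{k-1}\right]\quad(n\ge4),$$ $$\begin{aligned}c_4={}&\beta^4F_4(G)\binom{n-1}{k-1}+\frac{(2k-n-1)\beta^2\gamma^2\mathcal{M}_4^1(G)}{k-1}\binom{n-2}{k-2}+\beta\gamma^3\mathcal{C}_4^3(G)\left[\binom{n-4}{k-4}-\binom{n-4}{k-1}\right]\\&+2|\mathscr{C}_4(G)|\gamma^4\left[\binom{n-5}{k-5}-\binom{n-5}{k-1}\right]\\&+\left[\binom m2-\sum_{i=1}^n\binom{d(v_i)}2\right]\left[\binom{n-5}{k-5}-2\binom{n-5}{k-3}+\binom{n-5}{k-1}\right]\gamma^4\quad(n\ge5),\end{aligned}$$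 and $$\begin{aligned}c_5={}&\beta^5F_5(G)\binom{n-1}{k-1}+\frac{(2k-n-1)\beta^3\gamma^2\mathcal{M}_5^1(G)}{k-1}\binom{n-2}{k-2}+2\beta^2\gamma^3\mathcal{C}_5^3(G)\left[\binom{n-4}{k-4}+\binom{n-4}{k-1}\right]\\&+2\beta\gamma^4\mathcal{C}_5^4(G)\left[\binom{n-5}{k-5}-\binom{n-5}{k-1}\right]+\beta\gamma^4\mathcal{M}_5^2(G)\left[\binom{n-5}{k-5}-2\binom{n-5}{k-3}+\binom{n-5}{k-1}\right]\\&+2|\mathscr{C}_5(G)|\gamma^5\left[\binom{n-6}{k-6}-\binom{n-6}{k-1}\right]\\&+\sum_{j=1}^{|\mathscr{C}_3(G)|}2\big(m+3-\mathscr{T}_j(G)\big)\gamma^5\left[\binom{n-6}{k-6}+\binom{n-6}{k-3}-\binom{n-6}{k-4}-\binom{n-6}{k-1}\right]\quad(n\ge6).\end{aligned}$$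
   Context: Graphs are finite and simple. $D(G)$ is the diagonal degree matrix and $A(G)$ the adjacency matrix of $G$, with vertices $v_1,\dots,v_n$ and degrees $d(v_i)$. For a partition $\lambda$ of $n$, $\chi_\lambda$ is the irreducible character of $\mathcal{S}_n$ indexed by $\lambda$ (so $(n)$ gives the trivial and $(1^n)$ the sign character), and $\operatorname{Imm}_\lambda(M)=\sum_{\sigma\in\mathcal{S}_n}\chi_\lambda(\sigma)\prod_{i=1}^n m_{i\sigma(i)}$ for an $n\times n$ matrix $M=[m_{ij}]$; the coefficients $c_{\lambda,r}(M)$ are defined by $\operatorname{Imm}_\lambda(xI_n-M)=\sum_{r=0}^n(-1)^r c_{\lambda,r}(M)x^{n-r}$. $F_r$ is the $r$th elementary symmetric function and $F_r(G)=F_r(d(v_1),\dots,d(v_n))$. $\mathscr{C}_l(G)$ is the set of cycles of length $l$ in $G$ and $\mathscr{M}_l(G)$ the set of $l$-matchings (sets of $l$ pairwise disjoint edges). For a cycle $C$ (resp. matching $\mathfrak{M}$), $\mathfrak{D}_C(G)$ (resp. $\mathfrak{D}_{\mathfrak{M}}(G)$) is the sequence of degrees (in $G$) of the vertices of $G$ not on $C$ (resp. not covered by $\mathfrak{M}$). Put $\mathcal{C}_r^l(G)=\sum_{C\in\mathscr{C}_l(G)}F_{r-l}(\mathfrak{D}_C(G))$ and $\mathcal{M}_r^l(G)=\sum_{\mathfrak{M}\in\mathscr{M}_l(G)}F_{r-2l}(\mathfrak{D}_{\mathfrak{M}}(G))$. The triangles in $\mathscr{C}_3(G)$ are numbered,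 and $\mathscr{T}_j(G)$ is the sum of the degrees of the three vertices of the $j$th triangle. Binomial coefficients follow the usual convention ($\binom ab=0$ if $b<0$ or $b>a\ge0$).
   Formalization: Corrected: the bracket [binom(n-4,k-4)-binom(n-4,k-1)] in c_3 and c_4 and the |C_5(G)| bracket in c_5 take + instead of -; the C_4^3 term of c_4 gets a factor 2; c_2,...,c_5 are stated for k>=2 only, as they divide by k-1. *)

(* Defs.v *)
From HB Require Import structures.
From mathcomp Require Import all_boot all_order all_algebra all_fingroup.
From mathcomp Require Import mxrepresentation.
From mathcomp Require Import reals.

Set Implicit Arguments.
Unset Strict Implicit.
Unset Printing Implicit Defensive.

Import GRing.Theory.
Local Open Scope ring_scope.

(** ** Irreducible characters of the symmetric group *)

(* The Young diagram of [la] is filled with 0, 1, ..., n-1 row by row, so that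
   [i] sits in row [reshape_index la i] and column [reshape_offset la i]. *)
Definition row_stab (n : nat) (la : seq nat) : {set 'S_n} :=
  [set s : 'S_n | [forall i, reshape_index la (s i) == reshape_index la i]].

Definition col_stab (n : nat) (la : seq nat) : {set 'S_n} :=
  [set s : 'S_n | [forall i, reshape_offset la (s i) == reshape_offset la i]].

(* In [regular_repr F G], which acts on the right of row vectors, the basis
   vector of index [gring_index G g] stands for the group element [g]. *)
Definition young_symmetrizer (F : fieldType) (n : nat) (la : seq nat) :
    'rV[F]_#|[set: 'S_n]| :=
  \sum_(p in row_stab n la) \sum_(q in col_stab n la)
    (-1) ^+ (q : bool) *: delta_mx 0 (gring_index [set: 'S_n] (p * q)%g).

(* The Specht module of [la], as the submodule of the regular representation
   generated by the Young symmetrizer. In characteristic 0 it is absolutely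
   irreducible and its character is the same integer-valued function whatever
   the field F, so that F = R gives the usual (complex) character chi_la. *)
Definition specht_repr (F : fieldType) (n : nat) (la : seq nat) :=
  submod_repr (cyclic_mx_module (regular_repr F [set: 'S_n])
                                (young_symmetrizer F n la)).

Definition specht_char (F : fieldType) (n : nat) (la : seq nat) (s : 'S_n) : F :=
  \tr (specht_repr F n la s).

Definition hook (n k : nat) : seq nat := k :: nseq (n - k) 1%N.

(** ** Immanants *)

Definition immanant (A : pzRingType) (n : nat) (chi : 'S_n -> A) (M : 'M[A]_n) : A :=
  \sum_(s : 'S_n) chi s * \prod_(i < n) M i (s i).

Definition immanantal_poly (F : fieldType) (n : nat) (la : seq nat) (M : 'M[F]_n) :
    {poly F} :=
  immanant (fun s => (specht_char F la s)%:P) (char_poly_mx M).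

Definition imm_coef (F : fieldType) (n : nat) (la : seq nat) (M : 'M[F]_n)
    (r : nat) : F :=
  (-1) ^+ r * (immanantal_poly la M)`_(n - r).

Lemma immanantal_polyE (F : fieldType) (n : nat) (la : seq nat) (M : 'M[F]_n) :
  immanantal_poly la M =
    \sum_(r < n.+1) ((-1) ^+ r * imm_coef la M r) *: 'X^(n - r).
Proof.
have sz : (size (immanantal_poly la M) <= n.+1)%N.
  apply: (leq_trans (size_sum _ _ _)); apply/bigmax_leqP => s _.
  rewrite mul_polyC; apply: (leq_trans (size_scale_leq _ _)).
  apply: (leq_trans (size_poly_prod_leq _ _)).
  have : (\sum_(i < n) size (char_poly_mx M i (s i)) <= \sum_(i < n) 2)%N.
    apply: leq_sum => i _; rewrite !mxE.
    case: eqP => _ /=; first by rewrite mulr1n size_XsubC.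
    by rewrite sub0r size_polyN (leq_trans (size_polyC_leq1 _)).
  rewrite sum_nat_const !card_ord muln2 -addnn => h.
  by rewrite leq_subLR addnS ltnS.
apply/polyP => j; rewrite [RHS]coef_sum.
transitivity (\sum_(r < n.+1) (immanantal_poly la M)`_(n - r)
                *+ (j == n - r)%N); last first.
  apply: eq_bigr => r _.
  by rewrite coefZ coefXn /imm_coef mulrA -expr2 sqrr_sign mul1r mulr_natr.
have [jn | nj] := leqP j n.
  have lt : (n - j < n.+1)%N by rewrite ltnS leq_subr.
  rewrite (bigD1 (Ordinal lt)) //= subKn // eqxx mulr1n big1 ?addr0 // => r ne.
  case: eqP => [E | _]; last by rewrite mulr0n.
  case/eqP: ne; apply: val_inj => /=; rewrite E subKn //.
  by rewrite -ltnS ltn_ord.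
rewrite nth_default ?(leq_trans sz) // big1 // => r _.
by case: eqP => [E | _]; [rewrite E ltnNge leq_subr in nj | rewrite mulr0n].
Qed.

(** ** Graphs on the vertex set 'I_n *)

Section Graph.
Variables (n : nat) (e : rel 'I_n).

Definition deg (v : 'I_n) : nat := #|[set w | e v w]|.

Definition edges : {set {set 'I_n}} :=
  [set E : {set 'I_n} | [exists x, exists y, e x y && (E == [set x; y])]].

Definition adj_mx (R : pzRingType) : 'M[R]_n := \matrix_(i, j) (e i j)%:R.

Definition deg_mx (R : pzRingType) : 'M[R]_n := diag_mx (\row_i (deg i)%:R).

(* Cycles (and matchings) are identified with their sets of edges: distinct
   cycles may have the same vertices. The set of vertices of a cycle, or
   covered by a matching, is therefore its [cover]. *)
Definition cycle_edges (s : seq 'I_n) : {set {set 'I_n}} :=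
  [set [set x; next s x] | x in s].

Definition cycles (l : nat) : {set {set {set 'I_n}}} :=
  [set cycle_edges t | t : l.-tuple 'I_n & (2 < l)%N && ucycleb e t].

Definition matchings (l : nat) : {set {set {set 'I_n}}} :=
  [set M : {set {set 'I_n}} | [&& M \subset edges, trivIset M & #|M| == l]].

(* The r-th elementary symmetric function of the degrees (in the whole graph)
   of the vertices in A. *)
Definition esym_deg (r : nat) (A : {set 'I_n}) : nat :=
  \sum_(B : {set 'I_n} | (B \subset A) && (#|B| == r)) \prod_(v in B) deg v.

(* The next two are only meaningful for [l <= r], resp. [l.*2 <= r]. *)
Definition cyc_sum (l r : nat) : nat :=
  \sum_(C in cycles l) esym_deg (r - l) (~: cover C).

Definition match_sum (l r : nat) : nat :=
  \sum_(M in matchings l) esym_deg (r - l.*2) (~: cover M).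

Definition deg_sum (C : {set {set 'I_n}}) : nat := \sum_(v in cover C) deg v.

End Graph.

Definition binz (A : pzRingType) (a : nat) (b : int) : A :=
  match b with Posz b' => 'C(a, b')%:R | Negz _ => 0 end.

Arguments binz {A} a%_N b%_R.

(* Main.v *)
Require Import Defs.
From HB Require Import structures.
From mathcomp Require Import all_boot all_order all_algebra all_fingroup.
From mathcomp Require Import mxrepresentation.
From mathcomp Require Import reals.
From mathcomp Require Import zify ring.

Set Implicit Arguments.
Unset Strict Implicit.
Unset Printing Implicit Defensive.

Import GRing.Theory Num.Theory.
Local Open Scope ring_scope.

(** Two independent things have to be known: the value of a hook character at
    a permutation that moves few points, and the number of permutations of
    each such kind whose moves follow edges of the graph.

    Characters. Left multiplication by the Young symmetrizer of a hook is, up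
    to the scalar [hook_norm], a projection of the group algebra onto the
    Specht module ([hook_quasi_idempotent]), so the character is a trace on
    the whole group algebra ([mxtrace_submod], [specht_char_young]). The row
    and column sets of a hook share only the corner. Expanding a symmetrizer
    over the cosets of the stabilizer of the corner therefore compares the
    traces of neighbouring hooks ([tau_pieri]), and their sum is the trace of a
    product of two commuting symmetrizers, that is an induced character
    ([hook_char_pieri]). The latter is a sum of signs over the sets that the
    permutation [g] stabilizes, and such a set is a union of orbits; so the
    generating function of the values of all hooks at [g], times [1 + 'X], is
    the product over the orbits [O] of [1 - (- 'X) ^+ #|O|]
    ([hook_char_genfun]). As soon as [g] has a fixed point the factor
    [1 + 'X] cancels, and the binomial formulas are read off
    ([specht_char_hookE]).

    Counting. The [r]-th coefficient is the sum, over the permutations [s]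
    moving at most [r] points, of the character times a product of edge weights
    over the moved points times an elementary symmetric function of the
    degrees of the other vertices, scaled by powers of [beta] and [gamma]
    ([imm_coef_graph]). Each orbit of moved
    points has at least two points, so a permutation moving at most five
    points is the identity, a single cycle, or a product of two cycles of
    lengths 2 and 2 or 2 and 3 ([two_orbits]). Involutions along edges are
    matchings ([sum_involutions]). A cycle of length at least 3 in the graph
    has two orientations, whence the factors 2 ([sum_edge_cycles]).
    Products of a three-cycle and a transposition amount to an oriented
    triangle and an edge that avoids it ([card_edge_mixed],
    [card_edges_off_triangle]). The remaining sums over matchings of one or two
    edges are evaluated by double counting ([handshake], [card_matchings2]). *)

(** * Signed sums over symmetric groups on subsets *)

Lemma SymP (T : finType) (X : {set T}) (s : {perm T}) :
  reflect (forall x, x \notin X -> s x = x) (s \in Sym X).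
Proof.
rewrite inE; apply: (iffP subsetP) => [H x | H x].
  by apply: contraNeq => /H.
by apply: contraR => /H /eqP.
Qed.

Lemma Sym_sub (T : finType) (X Z : {set T}) (s : {perm T}) :
  X \subset Z -> s \in Sym X -> s \in Sym Z.
Proof.
move=> sXZ /SymP H; apply/SymP => x xZ; apply: H.
by apply: contra xZ; apply: (subsetP sXZ).
Qed.

Lemma tperm_Sym (T : finType) (X : {set T}) (x y : T) :
  x \in X -> y \in X -> tperm x y \in Sym X.
Proof.
move=> xX yX; apply/SymP => z zX; rewrite tpermD //.
  by apply: contraNneq zX => <-.
by apply: contraNneq zX => <-.
Qed.

Lemma Sym_conj (T : finType) (X : {set T}) (s h : {perm T}) :
  ((s ^ h)%g \in Sym (h @: X)) = (s \in Sym X).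
Proof.
apply/SymP/SymP => H x xX.
  have := H (h x); rewrite permJ mem_imset; last exact: perm_inj.
  by move=> /(_ xX) /perm_inj.
rewrite -[x](permKV h) permJ H //; apply: contra xX => xX.
by rewrite -[x](permKV h) imset_f.
Qed.

Lemma mulr_signCA (A : pzRingType) n (x y : A) :
  x * ((-1) ^+ n * y) = (-1) ^+ n * (x * y).
Proof. by rewrite !mulrA (commr_sign x). Qed.

Section YoungSums.

Variables (T : finType) (A : pzRingType) (L : {perm T} -> A).
Hypothesis L1 : L 1%g = 1.
Hypothesis LM : forall s t, L (s * t)%g = L s * L t.

Implicit Types (b : bool) (X Y Z : {set T}) (s t : {perm T}).

(** The row symmetrizer of [X] for [b = false], the column antisymmetrizer
    for [b = true]; keeping both in one definition makes every identity below
    serve for rows and for columns. *)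
Definition ysum b X : A := \sum_(s in Sym X) (-1) ^+ (b && s) * L s.

Lemma ysumV b X : ysum b X = \sum_(s in Sym X) (-1) ^+ (b && s) * L s^-1%g.
Proof.
rewrite /ysum (reindex_inj invg_inj).
by apply: eq_big => s; rewrite ?groupV // odd_permV.
Qed.

Lemma ysumML b X s :
  s \in Sym X -> L s * ysum b X = (-1) ^+ (b && s) * ysum b X.
Proof.
move=> sX; rewrite !mulr_sumr [RHS](reindex_inj (mulgI s)) /=.
apply: eq_big => [t | t tX]; first by rewrite groupMl.
rewrite odd_permM LM !mulrA -signr_addb (commr_sign (L s)).
by case: b; case: (s : bool); case: (t : bool).
Qed.

Lemma ysumMR b X s :
  s \in Sym X -> ysum b X * L s = (-1) ^+ (b && s) * ysum b X.
Proof.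
move=> sX; rewrite mulr_sumr mulr_suml [RHS](reindex_inj (mulIg s)) /=.
apply: eq_big => [t | t tX]; first by rewrite groupMr.
rewrite odd_permM LM !mulrA -signr_addb.
by case: b; case: (s : bool); case: (t : bool).
Qed.

Lemma ysumMM b X Z :
  X \subset Z -> ysum b X * ysum b Z = (#|X|`!)%:R * ysum b Z.
Proof.
move=> sXZ; rewrite {1}/ysum mulr_suml.
rewrite (eq_bigr (fun=> ysum b Z)) => [|s sX].
  by rewrite sumr_const card_Sym mulr_natl.
by rewrite -mulrA ysumML ?(Sym_sub sXZ) // signrMK.
Qed.

Lemma ysumMMr b X Z :
  X \subset Z -> ysum b Z * ysum b X = (#|X|`!)%:R * ysum b Z.
Proof.
move=> sXZ; rewrite {2}/ysum mulr_sumr.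
rewrite (eq_bigr (fun=> ysum b Z)) => [|s sX].
  by rewrite sumr_const card_Sym mulr_natl.
by rewrite mulrA (commr_sign (ysum b Z)) -mulrA ysumMR ?(Sym_sub sXZ) // signrMK.
Qed.

Lemma comm_ysum b X (u : A) :
  (forall s, s \in Sym X -> GRing.comm u (L s)) -> GRing.comm u (ysum b X).
Proof.
move=> H; apply: commr_sum => s sX; apply: commrM; last exact: H.
exact: commr_sign.
Qed.

Lemma comm_L_disjoint X Y s t :
  [disjoint X & Y] -> s \in Sym X -> t \in Sym Y -> GRing.comm (L s) (L t).
Proof.
move=> dXY; rewrite !inE => sX tY.
by rewrite /GRing.comm -!LM (perm_onC sX tY dXY).
Qed.

Lemma comm_ysum_disjoint b c X Y :
  [disjoint X & Y] -> GRing.comm (ysum b X) (ysum c Y).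
Proof.
move=> dXY; apply: comm_ysum => s sY; apply: commr_sym; apply: comm_ysum => t tX.
by apply: commr_sym; apply: (comm_L_disjoint dXY).
Qed.

Definition transp_sum z X : A := \sum_(x in X) L (tperm z x).

Lemma transp_sum_const z X u v w :
  (forall x, x \in X -> u * (L (tperm z x) * v) = w) ->
  u * (transp_sum z X * v) = w *+ #|X|.
Proof. by move=> H; rewrite mulr_suml mulr_sumr (eq_bigr _ H) sumr_const. Qed.

(** The identity and the transpositions at [z] represent the cosets of
    [Sym X] in [Sym (z |: X)]: a permutation is classified by its value at
    [z]. *)
Lemma ysumU1 b z X : z \notin X ->
  ysum b (z |: X) = ysum b X * (1 + (-1) ^+ b * transp_sum z X).
Proof.
move=> zX; rewrite {1}/ysum.
rewrite (partition_big (fun s : {perm T} => s z) (mem (z |: X))) /=; last first.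
  by move=> s; rewrite inE => sX; rewrite (perm_closed _ sX) setU11.
rewrite (eq_bigr (fun x => ysum b X * ((-1) ^+ (b && (z != x)) * L (tperm z x)))).
  rewrite big_setU1 //= eqxx andbF expr0 mul1r tperm1 L1 mulrDr; congr (_ + _).
  rewrite -mulr_sumr; congr (_ * _); rewrite mulr_sumr; apply: eq_bigr => x xX.
  by rewrite (_ : z != x) ?andbT //; apply: contraNneq zX => ->.
move=> x xzX; rewrite (reindex_inj (mulIg (tperm z x))) /= /ysum mulr_suml.
apply: eq_big => [t | t /andP [tX _]]; last first.
  rewrite odd_permM LM odd_tperm !mulrA; congr (_ * _).
  rewrite -[RHS]mulrA (commr_sign (L t)) mulrA -signr_addb; congr (_ ^+ _ * _).
  by case: b; case: (t : bool); case: (z != x).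
rewrite groupMr ?tperm_Sym ?setU11 //.
apply/andP/SymP => [[/SymP tX] | tX].
  rewrite permM => /eqP tz y yX; case: (eqVneq y z) => [-> | yz].
    by apply: (perm_inj (s := tperm z x)); rewrite tz tpermL.
  by rewrite tX // !inE negb_or yz.
split; last by rewrite permM tX // tpermL.
by apply/SymP => y; rewrite !inE negb_or => /andP [_ /tX].
Qed.

Lemma comm_transp_sum b z X : z \notin X ->
  GRing.comm (transp_sum z X) (ysum b X).
Proof.
move=> zX; apply: comm_ysum => s sX; rewrite /GRing.comm mulr_suml mulr_sumr.
rewrite [RHS](reindex_inj (@perm_inj _ s)) /=.
apply: eq_big => x; first by move: sX; rewrite inE => /perm_closed->.
move=> _; rewrite -!LM; congr L.
by rewrite -[z in RHS](SymP _ _ sX z zX) -tpermJ conjgE !mulgA mulgV mul1g.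
Qed.

Lemma ysumU1l b z X : z \notin X ->
  ysum b (z |: X) = (1 + (-1) ^+ b * transp_sum z X) * ysum b X.
Proof.
move=> zX; rewrite ysumU1 //; apply: commrD; first exact: commr1.
apply: commrM; first exact: commr_sign.
by apply: commr_sym; apply: comm_transp_sum.
Qed.

Lemma ysum_conj b X h : L h^-1 * ysum b X * L h = ysum b (h @: X).
Proof.
rewrite /ysum mulr_sumr mulr_suml [RHS](reindex_inj (conjg_inj h)) /=.
apply: eq_big => [s | s _]; first by rewrite Sym_conj.
by rewrite odd_permJ mulrA commr_sign -!mulrA -!LM.
Qed.

Section QuasiIdempotent.

Variables (b : bool) (z : T) (X Y : {set T}).
Hypotheses (zX : z \notin X) (zY : z \notin Y) (dXY : [disjoint X & Y]).
Hypothesis A2 : forall u : A, u = - u -> u = 0.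

Let aX := ysum b (z |: X).
Let bY := ysum (~~ b) (z |: Y).

Lemma ysum_corner_absorb y : y \in Y ->
  L (tperm z y) * (ysum b X * bY) = (-1) ^+ (~~ b) * (ysum b X * bY).
Proof.
move=> yY; have zy : z != y by apply: contraNneq zY => ->.
have C : GRing.comm (L (tperm z y)) (ysum b X).
  apply: comm_ysum => s sX; apply: (comm_L_disjoint (X := z |: Y) _ _ sX).
    by rewrite disjoints_subset subUset sub1set !inE zX -disjoints_subset
               disjoint_sym.
  by rewrite tperm_Sym ?setU11 // setU1r.
rewrite mulrA C -mulrA ysumML ?odd_tperm ?zy ?andbT ?tperm_Sym ?setU11 ?setU1r //.
exact: mulr_signCA.
Qed.

(** Since [(z x)(x y) = (x y)(z y)], the transposition [(z x)], absorbed by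
    the row factor with one sign, can be carried across [(x y)] and absorbed as
    [(z y)] by the column factor with the other sign. *)
Lemma ysum_tperm0 x y : x \in X -> y \in Y ->
  aX * L (tperm x y) * (ysum b X * bY) = 0.
Proof.
move=> xX yY.
have zx : z != x by apply: contraNneq zX => ->.
have xy : x != y.
  by apply: contraTneq yY => <-; rewrite (disjointFr dXY).
have E1 : aX * L (tperm z x) = (-1) ^+ b * aX.
  by rewrite ysumMR ?odd_tperm ?zx ?andbT // tperm_Sym ?setU11 // setU1r.
have E2 := ysum_corner_absorb yY.
have E3 : (tperm z x * tperm x y)%g = (tperm x y * tperm z y)%g.
  have -> : tperm z y = (tperm z x ^ tperm x y)%g.
    by rewrite tpermJ tpermL tpermD // 1?eq_sym //; apply: contraNneq zY => ->.
  by rewrite conjgE tpermV !mulgA tperm2 mul1g.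
apply: A2; set u := (X in X = _).
have E : (-1) ^+ b * u = (-1) ^+ (~~ b) * u.
  rewrite /u -!mulrA (mulrA _ aX) -E1 -(mulrA aX) (mulrA (L _)) -LM E3 LM.
  by rewrite -(mulrA (L _)) E2 !mulr_signCA.
apply: (can_inj (signrMK b)); rewrite -/u E.
by case: (b); rewrite /= !(expr0, expr1, mul1r, mulN1r, opprK).
Qed.

(** The first column factor is expanded over the cosets of [Sym Y]: the
    identity coset leaves [aX * aX], a multiple of [aX], and each transposition [(z y)] meets the second row factor. There it is
    absorbed by the column factor when the row coset is trivial, while the
    cosets of the [(z x)] give 0 because [(z y)(z x) = (z x)(x y)]. *)
Lemma hook_quasi_idempotent :
  aX * bY * (aX * bY) = ((#|X| + #|Y| + 1) * #|X|`! * #|Y|`!)%:R * (aX * bY).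
Proof.
have zXY : [disjoint z |: X & Y].
  by rewrite disjoints_subset subUset sub1set !inE zY -disjoints_subset.
have step y : y \in Y ->
    aX * L (tperm z y) * (aX * bY) =
    (-1) ^+ (~~ b) * ((#|X|`!)%:R * (aX * bY)).
  move=> yY.
  have E2 := ysum_corner_absorb yY.
  have vanish x : x \in X ->
      aX * L (tperm z y) * (L (tperm z x) * (ysum b X * bY)) = 0.
    move=> xX.
    have zx : z != x by apply: contraNneq zX => ->.
    have xy : x != y.
      by apply: contraTneq yY => <-; rewrite (disjointFr dXY).
    have E3 : (tperm z y * tperm z x)%g = (tperm z x * tperm x y)%g.
      have -> : tperm x y = (tperm z y ^ tperm z x)%g.
        by rewrite tpermJ tpermL tpermD //; apply: contraNneq zY => ->.
      by rewrite conjgE tpermV !mulgA tperm2 mul1g.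
    rewrite -(mulrA aX) (mulrA (L (tperm z y))) -LM E3 LM -!mulrA.
    rewrite (mulrA aX) ysumMR; last by rewrite tperm_Sym ?setU11 // setU1r.
    by rewrite -!mulrA (mulrA aX) ysum_tperm0 ?mulr0.
  rewrite {2}/aX ysumU1l // -(mulrA (1 + _)) mulrDl mul1r mulrDr.
  rewrite -(mulrA aX (L _) (_ * bY)) E2 !mulr_signCA (mulrA aX).
  rewrite ysumMMr ?subsetUr // -(mulrA (_ ^+ _)) mulr_signCA.
  by rewrite (transp_sum_const vanish) mul0rn mulr0 addr0 -!mulrA.
rewrite {1}/bY ysumU1 // !mulrA (comm_ysum_disjoint b (~~ b) zXY).
rewrite -/aX -!mulrA mulrDl mul1r (mulrDr aX).
rewrite (mulrA aX aX) ysumMMr // cardsU1 zX add1n.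
have -> : aX * ((-1) ^+ (~~ b) * transp_sum z Y * (aX * bY)) =
    (#|Y| * #|X|`!)%:R * (aX * bY).
  have step' y : y \in Y -> aX * (L (tperm z y) * (aX * bY)) =
      (-1) ^+ (~~ b) * ((#|X|`!)%:R * (aX * bY)) by move=> /step <-; rewrite mulrA.
  rewrite -(mulrA (_ ^+ _)) mulr_signCA (transp_sum_const step').
  by rewrite mulrnAr signrMK natrM -mulrA [RHS]mulr_natl.
rewrite -mulrA -mulrDl -natrD mulrA (commr_nat (ysum _ Y)) -mulrA.
rewrite (mulrA (ysum _ Y)) -(comm_ysum_disjoint b (~~ b) zXY) -/aX -mulrA.
rewrite ysumMM ?subsetUr // (mulrA aX) (commr_nat aX) -mulrA mulrA -natrM.
by congr (_ %:R * _); rewrite factS; ring.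
Qed.

End QuasiIdempotent.

Section Trace.

Variables (V : zmodType) (tau : {additive A -> V}).
Hypothesis tauC : forall s u, tau (L s * u) = tau (u * L s).

Lemma tau_ysum_conj b c X Y (h : {perm T}) :
  tau (ysum b (h @: X) * ysum c (h @: Y)) = tau (ysum b X * ysum c Y).
Proof.
rewrite -!ysum_conj !mulrA -(mulrA _ (L h)) -LM mulgV L1 mulr1 -!mulrA tauC.
by rewrite -!mulrA -LM mulgV L1 mulr1.
Qed.

(** When both kinds of enlarged symmetrizers are expanded over cosets, the
    transpositions that join [X] to [Y] occur in both sums, with opposite
    signs; only the identity cosets remain. *)
Lemma tau_pieri b X Y : [disjoint X & Y] ->
  \sum_(x in X) tau (ysum b X * ysum (~~ b) (x |: Y)) +
  \sum_(y in Y) tau (ysum b (y |: X) * ysum (~~ b) Y) =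
  tau (ysum b X * ysum (~~ b) Y) *+ (#|X| + #|Y|).
Proof.
move=> dXY; pose I := ysum b X * ysum (~~ b) Y.
have comm := comm_ysum_disjoint b (~~ b) dXY.
rewrite (eq_bigr (fun x => tau I + \sum_(y in Y)
    tau ((-1) ^+ (~~ b) * (I * L (tperm x y))))) => [|x xX]; last first.
  rewrite ysumU1 ?(disjointFr dXY) // mulrDr mulr1 mulrDr raddfD; congr (_ + _).
  rewrite -(raddf_sum tau); congr (tau _).
  by rewrite !mulr_signCA mulrA -/I -!mulr_sumr.
rewrite [X in _ + X](eq_bigr (fun y => tau I + \sum_(x in X)
    tau ((-1) ^+ b * (I * L (tperm x y))))) => [|y yY]; last first.
  rewrite ysumU1l ?(disjointFl dXY) // -mulrA -/I mulrDl mul1r raddfD.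
  congr (_ + _); rewrite -mulrA /transp_sum mulr_suml mulr_sumr raddf_sum.
  apply: eq_bigr => x _; rewrite tpermC.
  by case: (b); rewrite ?expr0 ?expr1 ?mul1r ?mulN1r ?raddfN tauC.
rewrite !big_split /= !sumr_const addrACA -mulrnDr.
rewrite [X in _ + (_ + X)]exchange_big -big_split /= [X in _ + X]big1 ?addr0 // => x _.
rewrite -big_split big1 //= => y _; rewrite -raddfD -mulrDl.
by case: (b); rewrite /= ?expr1 ?expr0 ?subrr ?addNr mul0r raddf0.
Qed.

End Trace.

End YoungSums.

(** * The group algebra acting on the left *)

(** The matrix [C] is [kappa] times a projection onto [U], so the trace of
    [C *m rG x] only sees the action of [x] on [U]. *)
Lemma mxtrace_submod (F : fieldType) (gT : finGroupType) (G : {group gT}) (n : nat)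
    (rG : mx_representation F G n) (U C : 'M[F]_n) (Umod : mxmodule rG U)
    (kappa : F) (x : gT) :
  x \in G -> kappa != 0 -> (C :=: U)%MS -> C *m C = kappa *: C ->
  \tr (submod_repr Umod x) = kappa^-1 * \tr (C *m rG x).
Proof.
move=> Gx k0 eqCU CC.
have projU m (W : 'M_(m, n)) : (W <= U)%MS -> W *m C = kappa *: W.
  by rewrite -eqCU => /submxP [D ->]; rewrite -mulmxA CC -scalemxAr.
have E1 : \tr (submod_repr Umod x) =
    \tr (val_submod (U := U) 1%:M *m rG x *m in_submod U 1%:M).
  by rewrite /submod_repr /= /submod_mx in_submodE.
have E2 : val_submod (U := U) 1%:M = kappa^-1 *: (val_submod (U := U) 1%:M *m C).
  by rewrite projU ?val_submodP // scalerA mulVf // scale1r.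
have trE r (P : 'M[F]_(n, r)) (Q : 'M_(r, n)) :
    C *m rG x *m P *m Q = C *m rG x -> \tr (Q *m C *m rG x *m P) = \tr (C *m rG x).
  by move=> PQ; rewrite -!mulmxA mxtrace_mulC !mulmxA PQ.
rewrite E1 E2 -!scalemxAl mxtraceZ; congr (_ * _); apply: trE.
by rewrite -val_submodE -in_submodE in_submodK // mxmodule_trans // eqCU.
Qed.

Section LeftRegular.

Variables (F : fieldType) (gT : finGroupType).
Let G := [set: gT]%G.
Let N := #|G|.
Let aG := regular_repr F G.

(** Matrices act on row vectors from the right, which reverses the order of
    left multiplications; the inverse restores it. *)
Definition left_mx (g : gT) : 'M[F]_N :=
  \matrix_i delta_mx 0 (gring_index G (g^-1 * enum_val i)%g).

Lemma delta_left_mx g h :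
  delta_mx 0 (gring_index G h) *m left_mx g =
  delta_mx 0 (gring_index G (g^-1 * h)%g) :> 'rV_N.
Proof. by rewrite -rowE rowK gring_indexK ?inE. Qed.

Lemma delta_regular_mx g h :
  delta_mx 0 (gring_index G h) *m aG g =
  delta_mx 0 (gring_index G (h * g)%g) :> 'rV_N.
Proof. by rewrite -rowE rowK gring_indexK ?inE. Qed.

Lemma gring_mxP (A B : 'M[F]_N) :
  (forall h, delta_mx 0 (gring_index G h) *m A =
             delta_mx 0 (gring_index G h) *m B :> 'rV_N) -> A = B.
Proof.
move=> H; apply/row_matrixP => i; rewrite !rowE.
by rewrite -[i](gring_valK i) H.
Qed.

Lemma left_mx1 : left_mx 1%g = 1.
Proof. by apply: gring_mxP => h; rewrite delta_left_mx invg1 mul1g mulmx1. Qed.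

Lemma left_mxM g h : left_mx (g * h)%g = left_mx g * left_mx h.
Proof.
apply: gring_mxP => u.
by rewrite mulmxA !delta_left_mx invMg mulgA.
Qed.

Lemma left_regular_comm g h : left_mx g *m aG h = aG h *m left_mx g.
Proof.
apply: gring_mxP => u; rewrite !mulmxA !(delta_left_mx, delta_regular_mx).
by rewrite mulgA.
Qed.

(** The diagonal entry at [h] tests whether [u^-1 * h * g = h], that is
    whether [u] is the conjugate of [g] by [h^-1]. *)
Lemma trace_left_regular u g :
  \tr (left_mx u *m aG g) = \sum_h (u == (g ^ h)%g)%:R.
Proof.
rewrite [RHS](reindex_inj invg_inj) [RHS](reindex_onto (@enum_val _ G)
  (gring_index G)) /= => [|h _]; last by rewrite gring_indexK ?inE.
rewrite (eq_bigl predT) => [|i]; last by rewrite gring_valK eqxx.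
apply: eq_bigr => i _; rewrite -[in LHS](gring_valK i); set h := enum_val i.
have entry (M : 'M[F]_N) a b : M a b = (delta_mx 0 a *m M : 'rV_N) 0 b.
  by rewrite -rowE mxE.
rewrite entry mulmxA delta_left_mx delta_regular_mx mxE eqxx /=.
rewrite (can_in_eq (@gring_indexK _ G)) ?inE //; congr (nat_of_bool _)%:R.
rewrite conjgE invgK mulgA eq_sym -(inj_eq (mulgI u)) !mulgA mulgV mul1g.
by rewrite -(inj_eq (mulIg h^-1%g)) -[(u * h * h^-1)%g]mulgA mulgV mulg1 eq_sym.
Qed.

Variables (I : finType) (P : pred I) (c : I -> F) (f : I -> gT).
Let v : 'rV[F]_N := \sum_(i | P i) c i *: delta_mx 0 (gring_index G (f i)).
Let C : 'M[F]_N := \sum_(i | P i) c i *: left_mx (f i)^-1%g.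

(** Row [h] of the left multiplication matrix is the generator [v] translated
    by [h]. *)
Lemma left_cyclic_mx : (C :=: cyclic_mx aG v)%MS.
Proof.
have rowC h : delta_mx 0 (gring_index G h) *m C = v *m aG h :> 'rV_N.
  rewrite mulmx_sumr mulmx_suml; apply: eq_bigr => s _.
  by rewrite -scalemxAr -scalemxAl delta_left_mx invgK delta_regular_mx.
apply/eqmxP/andP; split.
  apply/row_subP => i; rewrite rowE -[i](gring_valK i) rowC.
  by rewrite mxmodule_trans ?cyclic_mx_module ?cyclic_mx_id ?inE.
apply: cyclic_mx_sub.
  apply/mxmoduleP => x _; rewrite [X in (X <= _)%MS](_ : _ = aG x *m C) ?submxMl //.
  rewrite mulmx_suml mulmx_sumr; apply: eq_bigr => s _.
  by rewrite -scalemxAl -scalemxAr left_regular_comm.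
have := rowC 1%g; rewrite repr_mx1 mulmx1 => <-; exact: submxMl.
Qed.

End LeftRegular.

(** * Characters of hooks *)

Section HookStabilizers.

Variables (n k : nat).

Lemma reshape_index_hook i : (i < n)%N ->
  reshape_index (hook n k) i = if (i < k)%N then 0%N else (i - k).+1.
Proof.
move=> lt_i_n; case: ltnP => ik.
  by rewrite -{1}[i]/(flatten_index (hook n k) 0 i) flatten_indexKl.
have E : i = flatten_index (hook n k) (i - k).+1 0.
  rewrite /flatten_index /= take_nseq ?sumn_nseq; last by rewrite leq_sub2r // ltnW.
  by rewrite mul1n addn0 subnKC.
by rewrite {1}E flatten_indexKl //= nth_nseq ltn_sub2r // (leq_ltn_trans ik).
Qed.

Lemma reshape_offset_hook i : (i < n)%N ->
  reshape_offset (hook n k) i = if (i < k)%N then i else 0%N.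
Proof.
move=> lt_i_n; case: ltnP => ik.
  by rewrite -{1}[i]/(flatten_index (hook n k) 0 i) flatten_indexKr.
have E : i = flatten_index (hook n k) (i - k).+1 0.
  rewrite /flatten_index /= take_nseq ?sumn_nseq; last by rewrite leq_sub2r // ltnW.
  by rewrite mul1n addn0 subnKC.
by rewrite {1}E flatten_indexKr //= nth_nseq ltn_sub2r // (leq_ltn_trans ik).
Qed.

Lemma row_stab_hook : row_stab n (hook n k) = Sym [set i : 'I_n | i < k]%N.
Proof.
apply/setP => s; rewrite [LHS]inE; apply/forallP/SymP => H i.
  rewrite inE -leqNgt => ki; apply: val_inj.
  have := H i; rewrite !reshape_index_hook ?ltn_ord // [(i < k)%N]ltnNge ki /=.
  by case: ltnP => //= ksi /eqP [] /(congr1 (addn k)); rewrite !subnKC.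
rewrite !reshape_index_hook ?ltn_ord //.
have [ik | ki] := ltnP i k; last by rewrite H ?ltnNge ?ki // inE -leqNgt.
have sP : s \in Sym [set i : 'I_n | i < k]%N by apply/SymP.
move: sP; rewrite inE => /(perm_closed i); rewrite !inE ik => ->.
by [].
Qed.

Lemma col_stab_hook :
  col_stab n (hook n k) = Sym [set i : 'I_n | (i == 0 :> nat) || (k <= i)%N].
Proof.
apply/setP => s; rewrite [LHS]inE; apply/forallP/SymP => H i.
  rewrite inE negb_or -ltnNge => /andP [i0 ik]; apply: val_inj.
  have := H i; rewrite !reshape_offset_hook ?ltn_ord // ik.
  by case: ltnP => _ /eqP // E; rewrite -E in i0.
rewrite !reshape_offset_hook ?ltn_ord //.
set Y := [set i : 'I_n | _] in H.
have sP : s \in Sym Y by apply/SymP.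
have [iY | iY] := boolP (i \in Y); last by rewrite H.
have siY : s i \in Y by move: sP; rewrite inE => /(perm_closed i) ->.
have E (j : 'I_n) : j \in Y -> (if (j < k)%N then j : nat else 0%N) = 0%N.
  by rewrite inE; case: ltnP => //= _; rewrite orbF => /eqP.
by rewrite !E.
Qed.

End HookStabilizers.

Lemma exists_perm_map (T : finType) (s1 s2 : seq T) :
  uniq s1 -> uniq s2 -> size s1 = #|T| -> size s2 = #|T| ->
  exists h : {perm T}, map h s1 = s2.
Proof.
move=> U1 U2 sz1 sz2.
have sub1 : {subset s1 <= enum T} by move=> x _; rewrite mem_enum.
have all1 x : x \in s1.
  by rewrite (uniq_min_size U1 sub1 _).2 ?mem_enum // -cardE sz1.
have lt x : (index x s1 < #|T|)%N by rewrite -sz1 index_mem.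
have inj_f : injective (fun x => nth x s2 (index x s1)).
  move=> x y; rewrite (set_nth_default y) ?sz2 // => /eqP.
  rewrite nth_uniq ?sz2 // => /eqP E.
  by rewrite -(nth_index x (all1 x)) -(nth_index x (all1 y)) E.
exists (perm inj_f); case: s1 U1 sz1 {sub1} all1 lt inj_f => [|x0 s1] U1 sz1 all1 lt inj_f.
  by apply/esym/size0nil; rewrite sz2 -sz1.
apply: (@eq_from_nth _ x0) => [|i]; rewrite size_map ?sz1 // => lti.
rewrite (nth_map x0) ?sz1 // permE index_uniq ?sz1 //.
by apply: set_nth_default; rewrite sz2.
Qed.

(** Makes the trace attached to a hook depend only on the sizes of its arm
    and leg, and not on the filling of the diagram. *)
Lemma exists_perm_corner (T : finType) (z z' : T) (X Y X' Y' : {set T}) :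
  z \notin X -> z \notin Y -> [disjoint X & Y] ->
  z' \notin X' -> z' \notin Y' -> [disjoint X' & Y'] ->
  #|X| = #|X'| -> #|Y| = #|Y'| -> (#|X| + #|Y|).+1 = #|T| ->
  exists h : {perm T}, [/\ h z = z', h @: X = X' & h @: Y = Y'].
Proof.
move=> zX zY dXY zX' zY' dXY' cX cY cT.
have U (x : T) (P Q : {set T}) : x \notin P -> x \notin Q -> [disjoint P & Q] ->
    uniq (x :: enum P ++ enum Q).
  move=> xP xQ dPQ; rewrite /= mem_cat !mem_enum negb_or xP xQ cat_uniq /=.
  apply/and3P; split; rewrite ?enum_uniq //; apply/hasPn => y; rewrite !mem_enum => yQ.
  by rewrite (disjointFl dPQ yQ).
have [| |h] := exists_perm_map (U _ _ _ zX zY dXY) (U _ _ _ zX' zY' dXY').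
- by rewrite /= size_cat -!cardE.
- by rewrite /= size_cat -!cardE -cX -cY.
rewrite /= map_cat => -[hz /eqP]; rewrite eqseq_cat ?size_map -?cardE //.
case/andP => /eqP hX /eqP hY; exists h; split=> //; apply/setP => y.
  by rewrite -[y \in X']mem_enum -hX; apply/imsetP/mapP => -[x xX ->];
    exists x => //; move: xX; rewrite mem_enum.
by rewrite -[y \in Y']mem_enum -hY; apply/imsetP/mapP => -[x xX ->];
    exists x => //; move: xX; rewrite mem_enum.
Qed.

Section HookCharacters.

Variables (F : numFieldType) (n : nat).
Let L := @left_mx F 'S_n.
Let aG := regular_repr F [set: 'S_n].

(** Left multiplications commute with [aG g], and therefore move cyclically
    under this trace. *)
Definition conj_trace (g : 'S_n) (M : 'M[F]_#|[set: 'S_n]|) : F := \tr (M *m aG g).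

Fact conj_trace_is_additive g : zmod_morphism (conj_trace g).
Proof. by move=> M M'; rewrite /conj_trace mulmxBl raddfB. Qed.

HB.instance Definition _ g :=
  GRing.isZmodMorphism.Build _ _ (conj_trace g) (conj_trace_is_additive g).

Lemma conj_traceC g s u : conj_trace g (L s * u) = conj_trace g (u * L s).
Proof.
rewrite /conj_trace -[L s * u]/(L s *m u) -mulmxA mxtrace_mulC -!mulmxA.
by rewrite left_regular_comm.
Qed.

(** The product of the hook lengths of the diagram, by which the square of the
    Young symmetrizer differs from it. *)
Definition hook_norm k := (n * (k.-1)`! * (n - k)`!)%N.

(** Column factors come first because left multiplications are inverted in
    [left_mx]. *)
Lemma young_left_mx (la : seq nat) (X Y : {set 'I_n}) :
  row_stab n la = Sym X -> col_stab n la = Sym Y ->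
  (ysum L true Y *m ysum L false X :=: cyclic_mx aG (young_symmetrizer F n la))%MS.
Proof.
move=> rX cY; rewrite /young_symmetrizer rX cY pair_big.
rewrite -[X in (X :=: _)%MS]/(ysum L true Y * ysum L false X) !ysumV.
have -> : (\sum_(s in Sym Y) (-1) ^+ (true && s) * L s^-1%g) *
          (\sum_(s in Sym X) (-1) ^+ (false && s) * L s^-1%g) =
    \sum_(p | (p.1 \in Sym X) && (p.2 \in Sym Y))
       (-1) ^+ (p.2 : bool) *: left_mx F (p.1 * p.2)^-1%g.
  rewrite mulr_suml; under eq_bigr => q _ do rewrite mulr_sumr.
  rewrite exchange_big pair_big /=; apply: eq_bigr => -[p q] _ /=.
  rewrite expr0 mul1r invMg left_mxM -mulrA.
  by case: (q : bool); rewrite ?expr0 ?expr1 ?mul1r ?scale1r ?mulN1r ?scaleN1r.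
exact: left_cyclic_mx.
Qed.

(** The first row and the first column of the diagram meet only in the
    corner [z]. *)
Lemma hook_corner k : (0 < k <= n)%N ->
  exists z : 'I_n, exists X Y : {set 'I_n},
  [/\ z \notin X, z \notin Y, [disjoint X & Y], #|X| = k.-1 &
  [/\ #|Y| = (n - k)%N, z |: X = [set i : 'I_n | i < k]%N &
      z |: Y = [set i : 'I_n | (i == 0 :> nat) || (k <= i)%N]]].
Proof.
case/andP=> k0 kn; have n0 : (0 < n)%N := leq_trans k0 kn.
pose z := Ordinal n0.
pose X := [set i : 'I_n | 0 < i < k]%N; pose Y := [set i : 'I_n | k <= i]%N.
set X1 := [set i : 'I_n | i < k]%N; set Y1 := [set i | _].
have eX : X1 = z |: X.
  apply/setP => i; rewrite !inE -val_eqE /= [in RHS]lt0n.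
  by case: eqP => // ->.
have eY : Y1 = z |: Y by apply/setP => i; rewrite !inE -val_eqE.
have zX : z \notin X by rewrite inE.
have zY : z \notin Y by rewrite inE -ltnNge.
have dXY : [disjoint X & Y].
  by apply/pred0P => i /=; rewrite !inE; have [] //= := leqP k i; rewrite andbF.
have cX1 : #|X1| = k.
  have inj_w : injective (widen_ord kn) by move=> i j E; apply/val_inj/(congr1 val E).
  rewrite -[RHS](card_ord k) -(card_image inj_w).
  apply: eq_card => i; rewrite inE; apply/idP/imageP => [ik | [j _ ->]]; last exact: (ltn_ord j).
  by exists (Ordinal ik) => //; apply: val_inj.
have cX : #|X| = k.-1 by rewrite -[in RHS]cX1 eX cardsU1 zX.
have cY : #|Y| = (n - k)%N.
  have -> : Y = ~: X1 by apply/setP => i; rewrite !inE -leqNgt.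
  by rewrite cardsCs setCK card_ord cX1.
by exists z, X, Y; rewrite eX eY.
Qed.

(** Quasi-idempotence turns the trace on the Specht module into a trace on the
    group algebra. *)
Lemma specht_char_young k (g : 'S_n) : (0 < k <= n)%N ->
  conj_trace g (ysum L true [set i : 'I_n | (i == 0 :> nat) || (k <= i)%N] *
                ysum L false [set i : 'I_n | i < k]%N) =
  (hook_norm k)%:R * specht_char F (hook n k) g.
Proof.
move=> kn; have n0 : (0 < n)%N by lia.
have [z [X [Y [zX zY dXY cX [cY eX eY]]]]] := hook_corner kn.
rewrite disjoint_sym in dXY.
have kap0 : (hook_norm k)%:R != 0 :> F.
  by rewrite pnatr_eq0 -lt0n !muln_gt0 n0 !fact_gt0.
have A2 (M : 'M[F]_#|[set: 'S_n]|) : M = - M -> M = 0.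
  move=> E; apply/matrixP => i j; apply/eqP; rewrite !mxE.
  move/matrixP/(_ i j)/eqP: E; rewrite mxE -addr_eq0 -mulr2n mulrn_eq0.
  by case/orP.
have CC := hook_quasi_idempotent (@left_mx1 F _) (@left_mxM F _) true zY zX dXY A2.
have := mxtrace_submod (cyclic_mx_module aG (young_symmetrizer F n (hook n k)))
  (in_setT g) kap0 (young_left_mx (row_stab_hook n k) (col_stab_hook n k)).
rewrite -eX -eY /specht_char /specht_repr -/aG => -> //.
  by rewrite mulrA mulfV // mul1r.
have -> : hook_norm k = ((#|Y| + #|X| + 1) * #|Y|`! * #|X|`!)%N.
  by rewrite /hook_norm cX cY (_ : n - k + k.-1 + 1 = n)%N; [ring | lia].
by rewrite [LHS]CC mulr_natl scaler_nat.
Qed.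

End HookCharacters.

(** * Orbits and stable sets *)

Section Orbits.

Variable (T : finType).
Implicit Types (u s : {perm T}) (B O : {set T}).

Lemma porbits_partition u : partition (porbits u) [set: T].
Proof.
apply/and3P; split.
- apply/eqP/setP => x; rewrite inE; apply/bigcupP; exists (porbit u x).
    exact: imset_f.
  exact: porbit_id.
- apply/trivIsetP => _ _ /imsetP [x _ ->] /imsetP [y _ ->]; apply: contraR.
  case/pred0Pn => z /= /andP [zx zy].
  rewrite -!eq_porbit_mem in zx zy.
  by rewrite -(eqP zx) zy.
by apply/imsetP => -[x _ E]; have := porbit_id u x; rewrite -E inE.
Qed.

Lemma porbit_in_porbits u O x : O \in porbits u -> x \in O -> O = porbit u x.
Proof.
case/imsetP => y _ ->; rewrite -eq_porbit_mem => /eqP E; exact/esym.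
Qed.

Definition porbits_in u B := [set O in porbits u | O \subset B].

Lemma porbit_sub_inv u B x : u @: B = B -> (porbit u x \subset B) = (x \in B).
Proof.
move=> uB; apply/subsetP/idP => [-> // | xB y /porbitP [i ->]].
  exact: porbit_id.
rewrite permX; elim: i => //= i IH.
by rewrite -uB imset_f.
Qed.

Lemma porbits_in_partition u B : u @: B = B -> partition (porbits_in u B) B.
Proof.
move=> uB; have /and3P [_ tI n0] := porbits_partition u.
apply/and3P; split.
- apply/eqP/setP => x; apply/bigcupP/idP => [[O] | xB].
    by rewrite inE => /andP [_ /subsetP]; apply.
  exists (porbit u x); last exact: porbit_id.
  by rewrite inE imset_f //= porbit_sub_inv.
- by apply: trivIsetS tI; apply/subsetP => O; rewrite inE => /andP [].
by rewrite inE negb_and n0.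
Qed.

Lemma cover_porbits_inv u (J : {set {set T}}) :
  J \subset porbits u -> u @: cover J = cover J.
Proof.
move=> sJ; apply/eqP; rewrite eqEcard card_imset ?leqnn ?andbT; last exact: perm_inj.
apply/subsetP => _ /imsetP [x /bigcupP [O OJ xO] ->]; apply/bigcupP; exists O => //.
rewrite (porbit_in_porbits (subsetP sJ _ OJ) xO).
by have := mem_porbit u 1 x; rewrite expg1.
Qed.

Lemma cover_porbitsK u (J : {set {set T}}) :
  J \subset porbits u -> porbits_in u (cover J) = J.
Proof.
move=> sJ; have /and3P [_ tI n0] := porbits_partition u.
apply/setP => O; rewrite inE; apply/andP/idP => [[/imsetP [x _ ->]] | OJ]; last first.
  by split; [exact: (subsetP sJ) | exact: bigcup_sup].
move=> /subsetP /(_ _ (porbit_id u x)) /bigcupP [O' OJ' xO'].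
by rewrite -(porbit_in_porbits (subsetP sJ _ OJ') xO').
Qed.

(** Parity is defined from the number of orbits; as the sizes of the orbits add
    up to [#|T|], each of them may be given the sign of a cycle instead. *)
Lemma sign_porbits (R : comPzRingType) u :
  (-1) ^+ (u : bool) = \prod_(O in porbits u) - (-1) ^+ #|O| :> R.
Proof.
rewrite (eq_bigr (fun O => (-1) ^+ #|O| * -1)) => [|O _]; last by rewrite mulrN1.
rewrite big_split /= prodr_const -expr_sum -(card_partition (porbits_partition u)).
by rewrite cardsT /odd_perm signr_addb !signr_odd.
Qed.

Lemma restr_perm_inv u B x : u @: B = B -> restr_perm B u x = if x \in B then u x else x.
Proof.
move=> uB; case: ifP => xB; last by rewrite (out_perm (restr_perm_on _ _)) ?xB.
apply: restr_permE => //; rewrite !inE /=; apply/subsetP => y yB.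
by rewrite inE /= apermE -uB imset_f.
Qed.

Lemma porbits_in_restr u B : u @: B = B ->
  porbits_in (restr_perm B u) B = porbits_in u B.
Proof.
move=> uB; set r := restr_perm B u.
have rB : r @: B = B by rewrite im_restr_perm.
have E x : x \in B -> porbit r x = porbit u x.
  move=> xB; apply/setP => y.
  have I i : (r ^+ i)%g x = (u ^+ i)%g x /\ (u ^+ i)%g x \in B.
    rewrite !permX; elim: i => [//| i [IH1 IH2]] /=; rewrite IH1 restr_perm_inv // IH2.
    by split=> //; rewrite -uB imset_f.
  by apply/porbitP/porbitP => -[i ->]; exists i; rewrite (I i).1.
apply/setP => O; rewrite !inE; apply/andP/andP => -[/imsetP [x _ ->]];
  rewrite porbit_sub_inv // => xB; split; rewrite ?porbit_sub_inv //.
  by rewrite E // imset_f.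
by rewrite -E // imset_f.
Qed.

(** Outside of [B] the restricted permutation has only orbits of size 1, whose
    sign is 1. *)
Lemma sign_restr_perm (R : comPzRingType) u B : u @: B = B ->
  (-1) ^+ (restr_perm B u : bool) = \prod_(O in porbits_in u B) - (-1) ^+ #|O| :> R.
Proof.
move=> uB; set r := restr_perm B u; rewrite (sign_porbits R r).
rewrite (bigID (fun O => O \subset B)) /= [X in _ * X]big1 ?mulr1; last first.
  move=> O /andP [/imsetP [x _ ->]].
  rewrite porbit_sub_inv ?im_restr_perm // => xB.
  have -> : porbit r x = [set x].
    apply/setP => y; rewrite inE; apply/porbitP/eqP => [[i ->] | ->]; last first.
      by exists 0%N; rewrite perm1.
    by rewrite permX_fix // (out_perm (restr_perm_on _ _)).
  by rewrite cards1 expr1 opprK.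
rewrite -porbits_in_restr // -/r; apply: eq_bigl => O; by rewrite [in RHS]inE.
Qed.

Lemma prod_1D_subsets (R : comPzRingType) (I : finType) (P : {set I}) (w : I -> R) :
  \prod_(i in P) (1 + w i) = \sum_(J : {set I} | J \subset P) \prod_(i in J) w i.
Proof.
rewrite big_mkcond /= (eq_bigr (fun i => (if i \in P then w i else 0) + 1)); last first.
  by move=> i _; case: ifP; rewrite ?add0r // addrC.
rewrite bigA_distr [RHS]big_mkcond; apply: eq_bigr => J _; case: ifP => [sJP | nJP].
  rewrite [RHS]big_mkcond; apply: eq_bigr => i _; case: ifP => // iJ.
  by rewrite (subsetP sJP).
have [i iJ iP] := subsetPn (negbT nJP).
by rewrite (bigD1 i) //= iJ (negbTE iP) mul0r.
Qed.

(** A stable set is the union of the orbits that it contains, so both sides are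
    sums over the sets of orbits. *)
Lemma sum_inv_sets (R : comNzRingType) u :
  \sum_(B : {set T}) 'X^#|B| * (if u @: B == B then (-1) ^+ (restr_perm B u) else 0) =
  \prod_(O in porbits u) (1 - (- 'X) ^+ #|O|) :> {poly R}.
Proof.
rewrite prod_1D_subsets.
rewrite (eq_bigr (fun B => if u @: B == B then
    \prod_(O in porbits_in u B) - (- 'X) ^+ #|O| else 0)) => [|B _]; last first.
  case: eqP => uB; last by rewrite mulr0.
  rewrite sign_restr_perm // (card_partition (porbits_in_partition uB)) expr_sum.
  rewrite -big_split; apply: eq_bigr => O _ /=.
  by rewrite mulrN -mulN1r [in RHS]exprNn mulN1r mulrC.
rewrite -big_mkcond /= (reindex_onto cover (porbits_in u)) => [|B /eqP uB].
  apply: eq_big => [J | J /andP [_ /eqP ->] //].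
  apply/andP/idP => [[_ /eqP <-] | sJ].
    by apply/subsetP => O; rewrite inE => /andP [].
  by rewrite cover_porbits_inv ?cover_porbitsK.
exact: cover_partition (porbits_in_partition uB).
Qed.

Definition supp u : {set T} := [set x | u x != x].

Lemma supp_inv u : u @: supp u = supp u.
Proof.
apply/eqP; rewrite eqEcard card_imset ?leqnn ?andbT; last exact: perm_inj.
by apply/subsetP => _ /imsetP [y + ->]; rewrite !inE (inj_eq perm_inj).
Qed.

Lemma porbit_sub_supp u x : (porbit u x \subset supp u) = (x \in supp u).
Proof. exact: porbit_sub_inv (supp_inv u). Qed.

(** An orbit of size 1 contributes the factor [1 - (- 'X) = 1 + 'X]. *)
Lemma prod_porbits_supp (R : comNzRingType) u :
  \prod_(O in porbits u) (1 - (- 'X) ^+ #|O|) =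
  (1 + 'X) ^+ (#|T| - #|supp u|) *
  \prod_(O in porbits_in u (supp u)) (1 - (- 'X) ^+ #|O|) :> {poly R}.
Proof.
rewrite (bigID (fun O => O \subset supp u)) /= mulrC; congr (_ * _); last first.
  by apply: eq_bigl => O; rewrite inE.
have orb1 x : u x = x -> porbit u x = [set x].
  move=> ux; apply/setP => y; rewrite inE; apply/porbitP/eqP => [[i ->] | ->].
    by rewrite permX_fix.
  by exists 0%N; rewrite perm1.
rewrite (eq_bigl (fun O => O \in set1 @: (~: supp u))); last first.
  move=> O; apply/andP/imsetP => [[/imsetP [x _ ->]] | [x + ->]].
    by rewrite porbit_sub_supp inE negbK => /eqP ux; exists x; rewrite ?inE ?ux ?eqxx ?orb1.
  by rewrite !inE negbK => /eqP ux; rewrite -(orb1 x ux) porbit_sub_supp inE ux eqxx imset_f.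
rewrite big_imset /=; last by move=> x y _ _ /set1_inj.
rewrite (eq_bigr (fun=> 1 + 'X)) => [|x _]; last by rewrite cards1 expr1 opprK.
  by rewrite prodr_const -(cardsC (supp u)) addKn.
Qed.

End Orbits.

(** * Sums of neighbouring hook characters *)

Section HookPieri.

Variables (F : numFieldType) (n : nat).
Let L := @left_mx F 'S_n.

Lemma specht_char_corner k (g : 'S_n) (z : 'I_n) (X Y : {set 'I_n}) :
  (0 < k <= n)%N -> z \notin X -> z \notin Y -> [disjoint X & Y] ->
  #|X| = k.-1 -> #|Y| = (n - k)%N ->
  conj_trace g (ysum L true (z |: Y) * ysum L false (z |: X)) =
  (hook_norm n k)%:R * specht_char F (hook n k) g.
Proof.
move=> kn zX zY dXY cX cY; rewrite -specht_char_young //.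
have [z0 [X0 [Y0 [zX0 zY0 dXY0 cX0 [cY0 <- <-]]]]] := hook_corner kn.
have cT : (#|X| + #|Y|).+1 = #|'I_n| by rewrite card_ord cX cY; lia.
have [||h [hz hX hY]] := exists_perm_corner zX zY dXY zX0 zY0 dXY0 _ _ cT.
- by rewrite cX0.
- by rewrite cY0.
rewrite -hz -hX -hY -!imset_set1 -!imsetU.
by rewrite tau_ysum_conj //; [exact: left_mx1 | exact: left_mxM | exact: conj_traceC].
Qed.

(** Extended by 0 outside of [1 <= k <= n], so that Pieri's rule holds without
    boundary cases. *)
Definition hook_char k (g : 'S_n) : F :=
  if (0 < k <= n)%N then specht_char F (hook n k) g else 0.

(** A corner chosen outside of [X] joins the row set and gives the longer row;
    one chosen inside of [X] joins the column set and gives the shorter row.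
    The right-hand side is, up to the factorials, the character induced from
    the stabilizer of [X], trivial on [X] and sign on its complement. *)
Lemma hook_char_pieri (g : 'S_n) (X : {set 'I_n}) : (0 < n)%N ->
  (hook_char #|X| g + hook_char #|X|.+1 g) * (#|X|`! * #|~: X|`!)%:R =
  conj_trace g (ysum L true (~: X) * ysum L false X).
Proof.
move=> n0; have cXn : (#|~: X| + #|X|)%N = n by rewrite addnC cardsC card_ord.
have dX : [disjoint ~: X & X] by rewrite disjoints_subset.
have := tau_pieri (@left_mx1 F _) (@left_mxM F _) (@conj_traceC F n g) true dX.
rewrite cXn /= => E; apply: (@mulIf _ n%:R); first by rewrite pnatr_eq0 -lt0n.
rewrite [RHS]mulr_natr -E {E}.
have T1 x : x \in ~: X -> conj_trace g (ysum L true (~: X) * ysum L false (x |: X)) =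
    (hook_norm n #|X|.+1)%:R * hook_char #|X|.+1 g.
  move=> xX; have c := cardsD1 x (~: X); rewrite xX in c.
  have kn : (0 < #|X|.+1 <= n)%N by lia.
  rewrite /hook_char kn -{1}(setD1K xX) (specht_char_corner (k := #|X|.+1)) //.
  - by rewrite inE in xX.
  - by rewrite !inE eqxx.
  - by rewrite disjoint_sym (disjointWl (subD1set _ _)).
  - by lia.
have T2 y : y \in X -> conj_trace g (ysum L true (y |: ~: X) * ysum L false X) =
    (hook_norm n #|X|)%:R * hook_char #|X| g.
  move=> yX; have c := cardsD1 y X; rewrite yX in c.
  have kn : (0 < #|X| <= n)%N by lia.
  rewrite /hook_char kn -{2}(setD1K yX) (specht_char_corner (k := #|X|)) //.
  - by rewrite !inE eqxx.
  - by rewrite !inE yX.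
  - by rewrite disjoint_sym (disjointWr (subD1set _ _)).
  - by rewrite c.
  - by lia.
have E1 : (hook_norm n #|X|.+1)%:R * hook_char #|X|.+1 g *+ #|~: X| =
    (n * #|X|`! * #|~: X|`!)%:R * hook_char #|X|.+1 g.
  rewrite /hook_char; case: ifP => kn; last by rewrite !mulr0 mul0rn.
  rewrite -mulrnAl -mulrnA /hook_norm /=; congr (_%:R * _).
  by rewrite (_ : #|~: X| = (n - #|X|.+1).+1) ?factS; [ring | lia].
have E2 : (hook_norm n #|X|)%:R * hook_char #|X| g *+ #|X| =
    (n * #|X|`! * #|~: X|`!)%:R * hook_char #|X| g.
  rewrite /hook_char; case: ifP => kn; last by rewrite !mulr0 mul0rn.
  rewrite -mulrnAl -mulrnA /hook_norm; congr (_%:R * _).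
  rewrite (_ : #|~: X| = n - #|X|)%N; last by lia.
  case: #|X| kn => [|x] kn /=; first by [].
  by rewrite factS; ring.
by rewrite (eq_bigr _ T1) (eq_bigr _ T2) !sumr_const E1 E2 !natrM; ring.
Qed.

(** Written as a double sum, which is visibly invariant under conjugation; its
    only possible nonzero term has [q] and [p] equal to the restrictions of [u]
    to [B] and to its complement. *)
Definition split_sign (u : 'S_n) (B : {set 'I_n}) : F :=
  \sum_(q in Sym B) \sum_(p in Sym (~: B)) (-1) ^+ (q : bool) * (q * p == u)%g%:R.

Lemma conj_trace_split g (B : {set 'I_n}) :
  conj_trace g (ysum L true B * ysum L false (~: B)) =
  \sum_h split_sign (g ^ h)%g B.
Proof.
rewrite /ysum mulr_suml raddf_sum [RHS]exchange_big; apply: eq_bigr => q qB.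
rewrite mulr_sumr raddf_sum [RHS]exchange_big; apply: eq_bigr => p pB /=.
rewrite -mulr_sumr -(@trace_left_regular F) expr0 mul1r -mulrA -left_mxM.
by case: (q : bool); rewrite ?mul1r ?mulN1r ?expr1 ?raddfN.
Qed.

Lemma split_signJ u h (B : {set 'I_n}) :
  split_sign (u ^ h)%g (h @: B) = split_sign u B.
Proof.
rewrite /split_sign (reindex_inj (conjg_inj h)).
apply: eq_big => [q | q _]; first by rewrite Sym_conj.
rewrite (reindex_inj (conjg_inj h)); apply: eq_big => [p | p _].
  rewrite -[in RHS](Sym_conj _ p h); congr (_ \in Sym _).
  apply/setP => x; rewrite inE -[x](permKV h) !mem_imset ?inE //; exact: perm_inj.
by rewrite odd_permJ -conjMg (inj_eq (conjg_inj h)).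
Qed.

Lemma split_signE u (B : {set 'I_n}) :
  split_sign u B = if u @: B == B then (-1) ^+ (restr_perm B u : bool) else 0.
Proof.
have key q p : q \in Sym B -> p \in Sym (~: B) -> (q * p)%g = u ->
    u @: B = B /\ q = restr_perm B u.
  move=> qB /SymP pB E.
  have uq x : x \in B -> u x = q x.
    move=> xB; rewrite -E permM pB // inE negbK.
    by move: qB; rewrite inE => /perm_closed ->.
  have uB : u @: B = B.
    by rewrite (eq_in_imset uq) im_perm_on //; move: qB; rewrite inE.
  split=> //; apply/permP => x; rewrite restr_perm_inv //.
  by case: ifP => [/uq // | xB]; rewrite (SymP _ _ qB) ?xB.
case: eqP => [uB | nuB]; last first.
  rewrite /split_sign big1 // => q qB; rewrite big1 // => p pB.
  by case: eqP => [/(key _ _ qB pB) [] // | _]; rewrite mulr0.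
set r := restr_perm B u.
have rB : r \in Sym B by rewrite inE restr_perm_on.
rewrite /split_sign (bigD1 r) //= [X in _ + X]big1 ?addr0; last first.
  move=> q /andP [qB /eqP qr]; rewrite big1 // => p pB.
  by case: eqP => [/(key _ _ qB pB) [_ /qr] // | _]; rewrite mulr0.
have pB : (r^-1 * u)%g \in Sym (~: B).
  apply/SymP => x; rewrite inE negbK => xB; rewrite permM.
  have yB : (r^-1)%g x \in B by move: rB; rewrite -groupV inE => /perm_closed ->.
  by have := restr_perm_inv ((r^-1)%g x) uB; rewrite yB -/r permKV.
rewrite (bigD1 (r^-1 * u)%g) //= mulKVg eqxx mulr1 big1 ?addr0 // => p /andP [_ /eqP np].
by case: eqP => [E | _]; rewrite ?mulr0 //; case: np; rewrite -E mulKg.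
Qed.

(** The scalar on the left depends on the set [B] only through its size, so
    the trace can be averaged over all [B] of size [j]; the sum over conjugates
    of [g] then becomes a sum over the translates of [B], which are counted
    [n`!] times. *)
Lemma hook_char_rec j (g : 'S_n) : (0 < n)%N -> (j <= n)%N ->
  hook_char (n - j) g + hook_char (n - j).+1 g =
  \sum_(B : {set 'I_n} | #|B| == j) split_sign g B.
Proof.
move=> n0 jn; pose V := hook_char (n - j) g + hook_char (n - j).+1 g.
have VB (B : {set 'I_n}) : #|B| == j ->
    V * ((n - j)`! * j`!)%:R = \sum_h split_sign (g ^ h)%g B.
  move=> /eqP cB; rewrite -conj_trace_split.
  have cB' : #|~: B| = (n - j)%N by rewrite cardsCs setCK card_ord cB.
  have := hook_char_pieri g (~: B) n0; rewrite setCK cB' cB => ->.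
  by [].
(* Both sides are multiplied by [n`!]; there are ['C(n, j)] sets [B], and the
   factorials on the left combine with this binomial coefficient. *)
have nz : (n`!)%:R != 0 :> F by rewrite pnatr_eq0 -lt0n fact_gt0.
apply: (mulIf nz); transitivity (\sum_(B : {set 'I_n} | #|B| == j)
    \sum_h split_sign (g ^ h)%g B).
  rewrite -(eq_bigr _ VB) (eq_bigl (fun B => B \in [set B : {set 'I_n} | #|B| == j])).
    rewrite sumr_const card_draws card_ord -/V -mulrnAr -mulrnA -(bin_fact jn).
    by congr (_ * _%:R); ring.
  by move=> B; rewrite inE.
rewrite exchange_big (eq_bigr (fun=> \sum_(B : {set 'I_n} | #|B| == j) split_sign g B)).
  by rewrite sumr_const -[in RHS]card_Sn mulr_natr.
move=> h _; rewrite (reindex_inj (imset_inj (@perm_inj _ h))).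
by apply: eq_big => B; rewrite ?card_imset ?split_signJ //; apply: perm_inj.
Qed.

(** The hook case of the Murnaghan-Nakayama rule: the factor [1 + 'X] adds
    neighbouring hooks, and Pieri's rule identifies their sum. *)
Lemma hook_char_genfun (g : 'S_n) : (0 < n)%N ->
  (1 + 'X) * \poly_(j < n) hook_char (n - j) g =
  \prod_(O in porbits g) (1 - (- 'X) ^+ #|O|).
Proof.
move=> n0; rewrite -sum_inv_sets; apply/polyP => j.
rewrite mulrDl mul1r coefD coefXM !coef_poly coef_sum.
rewrite (eq_bigr (fun B : {set 'I_n} => if #|B| == j then split_sign g B else 0));
  last first.
  move=> B _; rewrite [X in _ * X](_ : _ = (split_sign g B)%:P).
    rewrite coefMC coefXn eq_sym; by case: eqP; rewrite ?mul1r ?mul0r.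
  by rewrite split_signE; case: eqP; rewrite ?rmorph_sign ?polyC0.
rewrite -big_mkcond /=.
have [jn | nj] := leqP j n; last first.
  rewrite big_pred0 => [|B]; last first.
    by apply/negbTE; rewrite neq_ltn (leq_ltn_trans _ nj) // -[X in (_ <= X)%N]card_ord max_card.
  by case: j nj => // j nj; rewrite !ifF ?addr0 //; lia.
rewrite -hook_char_rec //; congr (_ + _).
  by case: ltnP => // nj; rewrite /hook_char; have -> : (n - j = 0)%N by lia.
case: j jn => [|j] jn; first by rewrite subn0 /hook_char ltnn.
rewrite jn /=; congr hook_char; lia.
Qed.

(** A fixed point of [g] provides one factor [1 + 'X] on the other side, which
    cancels. *)
Lemma specht_char_hookE k (g : 'S_n) : (0 < k <= n)%N -> (#|supp g| < n)%N ->
  specht_char F (hook n k) g =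
  ((1 + 'X) ^+ (n - #|supp g| - 1) *
   \prod_(O in porbits_in g (supp g)) (1 - (- 'X) ^+ #|O|))`_(n - k).
Proof.
move=> kn sn; have n0 : (0 < n)%N by lia.
have X1 : 1 + 'X != 0 :> {poly F}.
  by rewrite addrC -[1]opprK -polyC1 -polyCN polyXsubC_eq0.
have := hook_char_genfun g n0; rewrite prod_porbits_supp card_ord.
rewrite (_ : n - #|supp g| = (n - #|supp g| - 1).+1)%N; last by lia.
rewrite exprS -mulrA => /(mulfI X1) E.
transitivity ((\poly_(j < n) hook_char (n - j) g)`_(n - k)); last first.
  by rewrite E subSS subn0.
rewrite coef_poly subKn ?(proj2 (andP kn)) // /hook_char kn ifT //; lia.
Qed.

End HookPieri.

(** * Values at permutations moving few points *)

(** Where the truncated difference [j - i] would mislead, both sides vanish: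
    the integer index of [binz] exceeds [N] when [j < i], and is negative when
    [j] is beyond the degree. *)
Lemma coef_1DXn (R : comNzRingType) N i j :
  ((1 + 'X) ^+ N * 'X^i)`_j = binz N (N%:Z + i%:Z - j%:Z) :> R.
Proof.
have C l : ((1 + 'X) ^+ N : {poly R})`_l = 'C(N, l)%:R.
  rewrite exprDn coef_sum; have [lN | Nl] := leqP l N.
    rewrite (bigD1 (Ordinal (lN : (l < N.+1)%N))) //= expr1n mul1r.
    rewrite coefMn coefXn eqxx big1 ?addr0 // => t tl.
    rewrite expr1n mul1r coefMn coefXn; case: eqP => [E | _]; last by rewrite mul0rn.
    by case/eqP: tl; apply: val_inj.
  rewrite bin_small // big1 // => t _; rewrite expr1n mul1r coefMn coefXn.
  case: eqP => [E | _]; last by rewrite mul0rn.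
  by have := ltn_ord t; rewrite -E ltnS leqNgt Nl.
rewrite coefMXn C; have [ji | ij] := ltnP j i.
  by rewrite (_ : _ - _ = (N + (i - j))%N%:Z) /=; [rewrite bin_small //|]; lia.
have [jN | Nj] := leqP (j - i) N.
  by rewrite (_ : _ - _ = (N - (j - i))%N%:Z) /=; [rewrite bin_sub // | lia].
rewrite bin_small // (_ : _ - _ = Negz (j - i - N).-1) //; lia.
Qed.

Section HookValues.

Variables (F : numFieldType) (n k : nat).
Hypothesis kn : (0 < k <= n)%N.
Let K := k%:Z.
Let chi := @specht_char F n (hook n k).

Let coefE N i c : (N + c)%N = n ->
  ((1 + 'X) ^+ N * 'X^i)`_(n - k) = binz N (K + i%:Z - c%:Z) :> F.
Proof. by move=> E; rewrite coef_1DXn; congr binz; rewrite /K; lia. Qed.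

Lemma hook_value1 : chi 1%g = binz (n - 1) (K - 1).
Proof.
have s1 : supp (1%g : 'S_n) = set0 by apply/setP => x; rewrite !inE perm1 eqxx.
rewrite /chi specht_char_hookE // s1 cards0; last by lia.
rewrite subn0 big_pred0; last first.
  move=> O; rewrite inE subset0; apply/negbTE; rewrite negb_and -implybE.
  by apply/implyP => /imsetP [x _ ->]; apply/set0Pn; exists x; exact: porbit_id.
by rewrite -(expr0 'X) (@coefE _ _ 1) ?addr0 //; lia.
Qed.

Lemma hook_value_single (s : 'S_n) l : #|supp s| = l -> (l < n)%N ->
  supp s \in porbits s ->
  chi s = binz (n - l.+1) (K - l.+1%:Z) - (-1) ^+ l * binz (n - l.+1) (K - 1).
Proof.
move=> sl ln ss; rewrite /chi specht_char_hookE // ?sl //.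
have -> : porbits_in s (supp s) = [set supp s].
  apply/setP => O; rewrite !inE; apply/andP/eqP => [[/imsetP [x _ ->]] | -> //].
  by move=> /subsetP /(_ x (porbit_id s x)) /(porbit_in_porbits ss) ->.
rewrite big_set1 sl -subnDA addn1 mulrBr coefB mulr1 (exprNn (polyX F)) mulrCA.
rewrite -[_ ^+ _ in X in X - _]mulr1 -(expr0 'X) (coefE _ (c := l.+1)); last by lia.
rewrite addr0; congr (_ - _).
rewrite -(rmorph_sign (@polyC F)) coefCM (coefE _ (c := l.+1)); last by lia.
by congr (_ * binz _ _); rewrite /K; lia.
Qed.

Lemma hook_value_pair (s : 'S_n) (A B : {set 'I_n}) a b :
  A != B -> porbits_in s (supp s) = [set A; B] -> #|A| = a -> #|B| = b ->
  #|supp s| = (a + b)%N -> (a + b < n)%N ->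
  chi s = let N := (n - (a + b).+1)%N in
    binz N (K - (a + b).+1%:Z) - (-1) ^+ a * binz N (K - b.+1%:Z)
    - (-1) ^+ b * binz N (K - a.+1%:Z) + (-1) ^+ (a + b) * binz N (K - 1).
Proof.
move=> AB sAB cA cB cs ln; rewrite /chi specht_char_hookE // ?cs // sAB.
rewrite big_setU1 ?inE //= big_set1 cA cB -subnDA addn1; set N := (n - _)%N.
have -> : (1 + 'X) ^+ N * ((1 - (- 'X) ^+ a) * (1 - (- 'X) ^+ b)) =
    (1 + 'X) ^+ N * 'X^0 - ((-1) ^+ a)%:P * ((1 + 'X) ^+ N * 'X^a)
    - ((-1) ^+ b)%:P * ((1 + 'X) ^+ N * 'X^b)
    + ((-1) ^+ (a + b))%:P * ((1 + 'X) ^+ N * 'X^(a + b)) :> {poly F}.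
  by rewrite !rmorph_sign expr0 !exprD !(exprNn (polyX F)); ring.
rewrite !coefD !coefN !coefCM !(coefE _ (c := (a + b).+1)); try by rewrite /N; lia.
by congr (_ - _ * binz _ _ - _ * binz _ _ + _ * binz _ _); try congr binz;
  rewrite /K; lia.
Qed.

(** The value of the hook character at a transposition; [k - 1] is cleared by
    the relation between consecutive binomial coefficients. *)
Lemma binz_transposition : (2 <= k)%N -> (3 <= n)%N ->
  binz (n - 3) (K - 3) - binz (n - 3) (K - 1) =
  (2 * k%:R - n%:R - 1) / (k%:R - 1) * binz (n - 2) (K - 2) :> F.
Proof.
move=> k2 n3; have [k' ek] : exists k', k = k'.+2 by exists (k - 2)%N; lia.
have [M eM] : exists M, n = (M + 3)%N by exists (n - 3)%N; lia.
have le : (k' <= M.+1)%N by lia.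
rewrite /K ek eM addnK (_ : M + 3 - 2 = M.+1)%N; last by lia.
have -> : Posz k'.+2 - 2 = k' by lia.
have -> : Posz k'.+2 - 1 = k'.+1 by lia.
have -> : binz M (Posz k'.+2 - 3) - binz M k'.+1 =
    'C(M.+1, k')%:R - 'C(M.+1, k'.+1)%:R :> F.
  case: (k') => [|j].
    by rewrite (_ : Posz 2 - 3 = Negz 0) //= !bin0 !bin1 -[M.+1]addn1 natrD; ring.
  by rewrite (_ : Posz j.+3 - 3 = j) /=; [rewrite !(binS M) !natrD; ring | lia].
have k0 : k'.+1%:R != 0 :> F by rewrite pnatr_eq0.
have E : k'.+1%:R * 'C(M.+1, k'.+1)%:R = (M.+1%:R - k'%:R) * 'C(M.+1, k')%:R :> F.
  by rewrite -natrM mul_bin_left natrM natrB.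
rewrite /= (_ : k'.+2%:R - 1 = k'.+1%:R :> F); last by rewrite -natr1 addrK.
apply: (mulfI k0); rewrite mulrBr E mulrA mulrCA mulrA mulfK //.
rewrite -mulrBl; congr (_ * _).
by rewrite -[k'.+2]addn2 -[k'.+1]addn1 -[M.+1]addn1 !natrD; ring.
Qed.

End HookValues.

(** * Coefficients of immanantal polynomials *)

Lemma fixed_out_supp (T : finType) (s : {perm T}) x : x \notin supp s -> s x = x.
Proof. by rewrite inE negbK => /eqP. Qed.

(** In the expansion of the product over the rows, [B] is the set of the rows
    where the entry of the matrix is chosen; elsewhere ['X] requires a fixed
    point. *)
Lemma imm_coefE (F : fieldType) n (la : seq nat) (M : 'M[F]_n) r : (r <= n)%N ->
  imm_coef la M r = \sum_(s : 'S_n) specht_char F la s *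
    \sum_(B : {set 'I_n} | (supp s \subset B) && (#|B| == r)) \prod_(i in B) M i (s i).
Proof.
move=> rn; rewrite /imm_coef /immanantal_poly /immanant coef_sum mulr_sumr.
apply: eq_bigr => s _; rewrite coefCM mulrCA; congr (_ * _).
have -> : \prod_(i < n) char_poly_mx M i (s i) =
    \prod_(i < n) (- (M i (s i))%:P + 'X *+ (i == s i)).
  by apply: eq_bigr => i _; rewrite !mxE addrC.
rewrite bigA_distr coef_sum mulr_sumr [RHS]big_mkcond; apply: eq_bigr => B _.
have [sB | nsB] := boolP (supp s \subset B) => /=; last first.
  have [i si iB] := subsetPn nsB.
  rewrite (bigD1 i) //= (negbTE iB) eq_sym; move: si; rewrite inE => /negbTE ->.
  by rewrite mulr0n mul0r coef0 mulr0.
rewrite (bigID (mem B)) /=.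
rewrite (eq_bigr (fun i => (- M i (s i))%:P)) => [|i iB]; last by rewrite iB polyCN.
rewrite [\prod_(i < n | i \notin B) _](eq_bigr (fun=> 'X)) => [|i iB]; last first.
  rewrite (negbTE iB) (fixed_out_supp (contra (subsetP sB i) iB)) eqxx //.
rewrite prodr_const -rmorph_prod coefCM coefXn prodrN.
have -> : #|[predC B]| = (n - #|B|)%N.
  by rewrite -[X in (X - _)%N](card_ord n) -(cardC (mem B)) addKn.
have Bn : (#|B| <= n)%N by rewrite -[X in (_ <= X)%N](card_ord n) max_card.
have -> : (n - r == n - #|B|)%N = (#|B| == r) by apply/eqP/eqP; lia.
by case: eqP => [-> | _]; rewrite ?mulr0 // mulr1 signrMK.
Qed.

Section GraphExpansion.

Variables (R : numFieldType) (n : nat) (e : rel 'I_n).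
Hypothesis e_irr : irreflexive e.

Definition along_edges (s : 'S_n) := [forall x, (s x != x) ==> e x (s x)].

Lemma along_edgesP s :
  reflect (forall x, x \in supp s -> e x (s x)) (along_edges s).
Proof.
by apply: (iffP forallP) => H x; have := H x; rewrite inE => /implyP.
Qed.

(** Moved points contribute edge weights and fixed points contribute degrees;
    only the fixed points of [B] remain to be chosen. *)
Lemma sum_prod_graph_mx (beta gamma : R) (s : 'S_n) r :
  let M := beta *: deg_mx e R + gamma *: adj_mx e R in
  \sum_(B : {set 'I_n} | (supp s \subset B) && (#|B| == r)) \prod_(i in B) M i (s i) =
  if along_edges s && (#|supp s| <= r)%N then
    gamma ^+ #|supp s| * beta ^+ (r - #|supp s|) *
    (esym_deg e (r - #|supp s|) (~: supp s))%:R
  else 0.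
Proof.
move=> M.
have Mfix i : i \notin supp s -> M i (s i) = beta * (deg e i)%:R.
  by move=> /fixed_out_supp ->; rewrite !mxE eqxx e_irr mulr0 addr0 mulr1n.
have Mmv i : i \in supp s -> M i (s i) = gamma * (e i (s i))%:R.
  by rewrite inE !mxE eq_sym => /negbTE ->; rewrite mulr0n mulr0 add0r.
case: ifP => [/andP [/along_edgesP sE sr] | H]; last first.
  rewrite big1 // => B /andP [sB /eqP cB].
  have : ~~ along_edges s.
    by apply: contraFN H => ->; rewrite -cB subset_leq_card.
  case/forallPn => i; rewrite negb_imply => /andP [si nei].
  have iS : i \in supp s by rewrite inE.
  by rewrite (bigD1 i) ?(subsetP sB) //= Mmv // (negbTE nei) mulr0 mul0r.
rewrite (reindex_onto (fun B' => supp s :|: B') (fun B => B :\: supp s)) /=; last first.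
  move=> B /andP [sB _]; apply/setP => i; rewrite !inE.
  have := subsetP sB i; rewrite inE; by case: (s i == i) => //= ->.
rewrite /esym_deg natr_sum mulr_sumr; apply: eq_big => [B | B].
  rewrite subsetUl /= setDUl setDv set0U.
  apply/andP/andP => [[/eqP c /eqP E] | [sB /eqP c]].
    have d : B \subset ~: supp s by rewrite -E subDset setUCr subsetT.
    split=> //; rewrite -c cardsU (_ : supp s :&: B = set0) ?cards0 ?subn0 ?addKn //.
    by apply/eqP; rewrite setI_eq0 disjoint_sym disjoints_subset.
  have I0 : supp s :&: B = set0.
    by apply/eqP; rewrite setI_eq0 disjoint_sym disjoints_subset.
  split; first by rewrite cardsU I0 cards0 subn0 c subnKC.
  by apply/eqP; apply/setDidPl; rewrite disjoints_subset.
case/andP => /andP [_ /eqP c] /eqP E.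
have d : [disjoint supp s & B].
  rewrite disjoint_sym disjoints_subset -E setDUl setDv set0U subDset setUCr.
  exact: subsetT.
rewrite [LHS](eq_bigl (fun i => i \in [predU (supp s) & B])) => [|i]; last by rewrite in_setU.
rewrite bigU //= (eq_bigr (fun=> gamma)) => [|i iS]; last first.
  by rewrite Mmv // sE // mulr1.
rewrite prodr_const -mulrA; congr (_ * _).
rewrite (eq_bigr (fun i => beta * (deg e i)%:R)) => [|i iB]; last first.
  by rewrite Mfix // (disjointFl d).
rewrite big_split /= prodr_const natr_prod; congr (_ ^+ _ * _).
by rewrite -c cardsU (_ : supp s :&: B = set0) ?cards0 ?subn0 ?addKn //;
   apply/eqP; rewrite setI_eq0.
Qed.

Lemma imm_coef_graph (la : seq nat) (beta gamma : R) r : (r <= n)%N ->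
  imm_coef la (beta *: deg_mx e R + gamma *: adj_mx e R) r =
  \sum_(u < r.+1) gamma ^+ u * beta ^+ (r - u) *
    \sum_(s : 'S_n | along_edges s && (#|supp s| == u))
       specht_char R la s * (esym_deg e (r - u) (~: supp s))%:R.
Proof.
move=> rn; rewrite imm_coefE //.
under eq_bigr => s _ do rewrite sum_prod_graph_mx.
rewrite (bigID (fun s => along_edges s && (#|supp s| <= r)%N)) /=.
rewrite [X in _ + X]big1 ?addr0 => [|s /negbTE ->]; last by rewrite mulr0.
rewrite (partition_big (fun s : 'S_n => inord #|supp s| : 'I_r.+1) xpredT) //=.
apply: eq_bigr => u _; rewrite mulr_sumr; apply: eq_big => [s | s].
  case: along_edges => //=; apply/andP/eqP => [[sr /eqP <-] | ->].
    by rewrite inordK.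
  by rewrite -ltnS ltn_ord inord_val eqxx.
case/andP => /andP [-> sr] /eqP <-; rewrite sr inordK //=.
by rewrite !mulrA; congr (_ * _); rewrite -mulrA mulrC.
Qed.

End GraphExpansion.

(** * Cycle types of permutations moving at most five points *)

Section CycleTypes.

Variable (T : finType).
Implicit Types (s t : {perm T}) (x y : T).

Lemma mem_supp_perm s x : (s x \in supp s) = (x \in supp s).
Proof. by rewrite !inE (inj_eq perm_inj). Qed.

Lemma suppV s : supp s^-1 = supp s.
Proof.
by apply/setP => x; rewrite !inE -(inj_eq (@perm_inj _ s)) permKV eq_sym.
Qed.

Lemma perm_on_supp s : perm_on (supp s) s.
Proof. by apply/subsetP => x; rewrite !inE. Qed.

Lemma mem_porbit1 s x : s x \in porbit s x.
Proof. by have := mem_porbit s 1 x; rewrite expg1. Qed.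

Lemma card_porbit_supp s x : x \in supp s -> (2 <= #|porbit s x|)%N.
Proof.
rewrite inE eq_sym => sx.
apply: leq_trans (subset_leq_card (_ : [set x; s x] \subset porbit s x)).
  by rewrite cards2 sx.
by rewrite subUset !sub1set porbit_id mem_porbit1.
Qed.

Lemma porbit_card2 s x : #|porbit s x| = 2%N -> s (s x) = x.
Proof. by move=> c; have := iter_porbit s x; rewrite c. Qed.

Lemma disjoint_porbits s x y :
  y \notin porbit s x -> [disjoint porbit s x & porbit s y].
Proof.
apply: contraR => /pred0Pn [z /= /andP [zx zy]].
by rewrite -eq_porbit_mem; rewrite -!eq_porbit_mem in zx zy; rewrite -(eqP zx) eq_sym.
Qed.

Lemma cards_disjointU (A B : {set T}) :
  [disjoint A & B] -> #|A :|: B| = (#|A| + #|B|)%N.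
Proof. by move=> d; rewrite cardsU (disjoint_setI0 d) cards0 subn0. Qed.

(** Orbits of moved points have at least two points, so at most two of them
    fit into five points, and one of these two has size 2. *)
Lemma two_orbits s :
  supp s != set0 -> supp s \notin porbits s -> (#|supp s| <= 5)%N ->
  exists A, exists B, [/\ A != B, porbits_in s (supp s) = [set A; B],
    #|A| = 2%N, (2 <= #|B|)%N & #|supp s| = (2 + #|B|)%N].
Proof.
move=> /set0Pn [x xs] ns s5.
have sub z : z \in supp s -> porbit s z \subset supp s by rewrite porbit_sub_supp.
have [y ys yx] : exists2 y, y \in supp s & y \notin porbit s x.
  apply/subsetPn; apply: contra ns => sx.
  by rewrite (_ : supp s = porbit s x) ?imset_f //; apply/eqP; rewrite eqEsubset sx sub.
have cx := card_porbit_supp xs; have cy := card_porbit_supp ys.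
have dxy := disjoint_porbits yx.
have cU := cards_disjointU dxy.
have eU : supp s = porbit s x :|: porbit s y.
  apply/eqP; rewrite eq_sym eqEsubset subUset !sub //=; apply: contraT.
  case/subsetPn => z zs; rewrite inE negb_or => /andP [zx zy].
  have cz := card_porbit_supp zs.
  have dz : [disjoint porbit s x :|: porbit s y & porbit s z].
    by rewrite -setI_eq0 setIUl !disjoint_setI0 ?setU0 ?disjoint_porbits.
  have : (#|porbit s x :|: porbit s y| + #|porbit s z| <= #|supp s|)%N.
    by rewrite -cards_disjointU // subset_leq_card // !subUset !sub.
  by rewrite cU; lia.
have pE : porbits_in s (supp s) = [set porbit s x; porbit s y].
  apply/setP => O; rewrite !inE; apply/andP/orP => [[/imsetP [z _ ->]] | ].
    rewrite porbit_sub_supp eU inE -!eq_porbit_mem => /orP [] /eqP ->; rewrite eqxx; auto.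
  by case=> /eqP ->; rewrite imset_f // sub.
have nxy : porbit s x != porbit s y by rewrite eq_porbit_mem porbit_sym.
have cs : #|supp s| = (#|porbit s x| + #|porbit s y|)%N by rewrite {1}eU.
have [c2 | c3] := leqP #|porbit s x| 2.
  by exists (porbit s x), (porbit s y); split=> //; lia.
exists (porbit s y), (porbit s x); split=> //; try lia.
  by rewrite eq_sym.
by rewrite setUC.
Qed.

End CycleTypes.

(** * Matchings and involutions *)

Section PermEdges.

Variables (n : nat) (e : rel 'I_n).
Hypotheses (e_sym : symmetric e) (e_irr : irreflexive e).
Implicit Types (s t : 'S_n) (x y : 'I_n).

Definition perm_edges s : {set {set 'I_n}} := [set [set x; s x] | x in supp s].

Lemma cover_perm_edges s : cover (perm_edges s) = supp s.
Proof.
rewrite cover_imset; apply/setP => x; apply/bigcupP/idP => [[y ys] | xs].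
  by rewrite in_set2 => /orP [] /eqP ->; rewrite ?mem_supp_perm.
by exists x; rewrite // !inE eqxx.
Qed.

Lemma perm_edges_sub s : along_edges e s -> perm_edges s \subset edges e.
Proof.
move=> /along_edgesP H; apply/subsetP => _ /imsetP [x xs ->].
by rewrite inE; apply/existsP; exists x; apply/existsP; exists (s x); rewrite H //= eqxx.
Qed.

Lemma edgesP (S : {set 'I_n}) :
  reflect (exists x y, e x y /\ S = [set x; y]) (S \in edges e).
Proof.
rewrite inE; apply: (iffP existsP) => [[x /existsP [y /andP [exy /eqP ->]]] | [x [y [exy ->]]]].
  by exists x, y.
by exists x; apply/existsP; exists y; rewrite exy eqxx.
Qed.

Lemma edge_neq x y : e x y -> x != y.
Proof. by apply: contraTneq => ->; rewrite e_irr. Qed.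

Lemma card_edge (S : {set 'I_n}) : S \in edges e -> #|S| = 2%N.
Proof. by case/edgesP => x [y [exy ->]]; rewrite cards2 (edge_neq exy). Qed.

Lemma set2_eq (T : finType) (a b c : T) : [set a; b] = [set a; c] -> b = c.
Proof.
move=> E; have := set22 a b; rewrite E !inE => /orP [/eqP ba | /eqP //].
by have := set22 a c; rewrite -E !inE ba orbb => /eqP.
Qed.

Definition edge_involution l s :=
  [&& along_edges e s, (s * s == 1)%g & #|supp s| == l.*2].

Lemma involutionK s x : (s * s == 1)%g -> s (s x) = x.
Proof. by move/eqP => ss; rewrite -permM ss perm1. Qed.

Lemma perm_edges_involution_inj l :
  {in [set s | edge_involution l s] &, injective perm_edges}.
Proof.
have fwd s t x : (s * s == 1)%g -> (t * t == 1)%g -> perm_edges s = perm_edges t ->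
    s x != x -> t x = s x.
  move=> ss tt E sx.
  have : [set x; s x] \in perm_edges t by rewrite -E; apply: imset_f; rewrite inE.
  case/imsetP => y _ E2.
  have : x \in [set y; t y] by rewrite -E2 !inE eqxx.
  rewrite !inE => /orP [/eqP xy | /eqP xy]; first by apply: (@set2_eq _ x); rewrite E2 xy.
  by apply: (@set2_eq _ x); rewrite E2 xy involutionK // setUC.
move=> s t; rewrite !inE => /and3P [_ ss _] /and3P [_ tt _] E.
apply/permP => x; have [sx | sx] := eqVneq (s x) x; last by apply/esym/fwd.
by have [tx | tx] := eqVneq (t x) x; [rewrite sx tx | apply: fwd].
Qed.

Lemma trivIset_perm_edges s : (s * s == 1)%g -> trivIset (perm_edges s).
Proof.
move=> ss; apply/trivIsetP => _ _ /imsetP [x _ ->] /imsetP [y _ ->].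
apply: contraR => /pred0Pn [z /=]; rewrite !inE => /andP [].
have h a b : a \in [set b; s b] -> [set b; s b] = [set a; s a].
  by rewrite !inE => /orP [] /eqP -> //; rewrite involutionK // setUC.
move=> zx zy; rewrite (h z x) ?inE // (h z y) ?inE //.
Qed.

Definition matching_partner (M : {set {set 'I_n}}) x : 'I_n :=
  odflt x [pick y in pblock M x :\ x].

Lemma matching_partner_out (M : {set {set 'I_n}}) x :
  x \notin cover M -> matching_partner M x = x.
Proof.
rewrite -mem_pblock /matching_partner => xM; case: pickP => //= y.
by rewrite inE => /andP [_]; rewrite /pblock; case: pickP => /= [S /andP [SM xS] | _];
  [move: xM; rewrite mem_pblock => /bigcupP []; exists S | rewrite inE].
Qed.

Lemma matching_partner_in l (M : {set {set 'I_n}}) S x :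
  M \in matchings e l -> S \in M -> x \in S ->
  [/\ S = [set x; matching_partner M x], e x (matching_partner M x) &
      matching_partner M (matching_partner M x) = x].
Proof.
rewrite inE => /and3P [ME tM _] SM xS.
have key x' y' : S = [set x'; y'] -> x' != y' -> matching_partner M x' = y'.
  move=> ES xy; have x'S : x' \in S by rewrite ES !inE eqxx.
  rewrite /matching_partner (def_pblock tM SM x'S) ES.
  case: pickP => [z | /(_ y')] /=; rewrite !inE.
    by case/andP => /negbTE -> /= /eqP.
  by rewrite eqxx orbT andbT eq_sym xy.
have /edgesP [a [b [eab ES]]] := subsetP ME _ SM.
have ab := edge_neq eab.
have ES' : S = [set b; a] by rewrite setUC.
have pa := key _ _ ES ab; have pb := key b a ES'; rewrite eq_sym ab in pb.
move: xS; rewrite {1}ES !inE => /orP [] /eqP ->.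
  by rewrite pa pb.
by rewrite pb // pa e_sym.
Qed.

Lemma perm_edges_involutions l :
  perm_edges @: [set s | edge_involution l s] = matchings e l.
Proof.
apply/setP => M; apply/imsetP/idP => [[s] | MM].
  rewrite inE => /and3P [sE ss /eqP cs] ->.
  have tI := trivIset_perm_edges ss.
  rewrite inE perm_edges_sub // tI /=.
  have := card_uniform_partition (n := 2) (P := perm_edges s) (D := supp s).
  rewrite cs muln2 => H; rewrite -(inj_eq double_inj) H // => [S /imsetP [x xs ->] | ].
    by rewrite cards2; move: xs; rewrite inE eq_sym => ->.
  apply/and3P; split=> //; first by rewrite cover_perm_edges.
  by apply/imsetP => -[x _ E]; have := set21 x (s x); rewrite -E inE.
have MM' := MM; rewrite inE in MM'; case/and3P: MM' => ME tM /eqP cM.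
have invK : involutive (matching_partner M).
  move=> x; have [/bigcupP [S SM xS] | xM] := boolP (x \in cover M).
    by have [] := matching_partner_in MM SM xS.
  by rewrite !(matching_partner_out xM).
pose s := perm (can_inj invK).
have sp : supp s = cover M.
  apply/setP => x; rewrite inE permE; apply/idP/idP => [|/bigcupP [S SM xS]].
    by apply: contraR => /matching_partner_out ->.
  have [_ + _] := matching_partner_in MM SM xS.
  by move/edge_neq; rewrite eq_sym.
exists s.
  rewrite inE; apply/and3P; split.
  - apply/along_edgesP => x; rewrite sp permE => /bigcupP [S SM xS].
    by have [] := matching_partner_in MM SM xS.
  - by apply/eqP/permP => x; rewrite permM perm1 !permE invK.
  have pM : partition M (cover M).
    apply/and3P; split=> //; apply/negP => /(subsetP ME) /card_edge.
    by rewrite cards0.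
  rewrite sp (card_uniform_partition _ pM (n := 2)) ?cM ?muln2 // => S SM.
  exact: card_edge (subsetP ME _ SM).
apply/setP => S; apply/idP/imsetP => [SM | [x]].
  have /edgesP [a [b [eab ES]]] := subsetP ME _ SM.
  have aS : a \in S by rewrite ES !inE eqxx.
  exists a; first by rewrite sp; apply/bigcupP; exists S.
  by rewrite permE; have [] := matching_partner_in MM SM aS.
rewrite sp permE => /bigcupP [S' SM xS] ->.
by have [<-] := matching_partner_in MM SM xS.
Qed.

(** An involution along edges exchanges the ends of the edges of a matching and
    fixes the other vertices. *)
Lemma sum_involutions (V : nmodType) (f : {set 'I_n} -> V) l :
  \sum_(s | edge_involution l s) f (supp s) = \sum_(M in matchings e l) f (cover M).
Proof.
rewrite -perm_edges_involutions big_imset /=; last exact: perm_edges_involution_inj.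
by apply: eq_big => [s | s _]; rewrite ?inE ?cover_perm_edges.
Qed.

End PermEdges.

Arguments perm_edges {n} s.

(** * Cycles of the graph and cyclic permutations *)

Section GraphCycles.

Variables (n : nat) (e : rel 'I_n).
Hypotheses (e_sym : symmetric e) (e_irr : irreflexive e).
Implicit Types (s t : 'S_n) (x y : 'I_n).

Definition edge_cycle (l : nat) s :=
  [&& along_edges e s, supp s \in porbits s & #|supp s| == l].

Lemma porbit_fconnect s x y : (y \in porbit s x) = fconnect s x y.
Proof.
apply/porbitP/idP => [[i ->] | /iter_findex <-]; first by rewrite permX fconnect_iter.
by exists (findex s x y); rewrite permX.
Qed.

(** The successor function of a cyclic sequence is a cyclic permutation. *)
Lemma perm_edges_cycles l : (2 < l)%N ->
  perm_edges @: [set s | edge_cycle l s] = cycles e l.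
Proof.
move=> l2; apply/setP => C; apply/imsetP/imsetP => [[s] | [t]].
  rewrite inE => /and3P [/along_edgesP sE /imsetP [x _ sx] /eqP cs] ->.
  have ot y : (y \in fingraph.orbit s x) = (y \in supp s).
    by rewrite sx porbit_fconnect fconnect_orbit.
  have sz : size (fingraph.orbit s x) == l.
    by rewrite -cs -(card_uniqP (orbit_uniq s x)) -(eq_card ot).
  have cyc : fcycle s (fingraph.orbit s x) by apply: cycle_orbit; apply: perm_inj.
  exists (Tuple sz).
    rewrite inE l2 /ucycleb /= orbit_uniq andbT.
    apply: cycle_from_next (orbit_uniq _ _) _ => y yo.
    by rewrite (nextE cyc yo) sE // -ot.
  apply/setP => S; apply/imsetP/imsetP => -[y yo ->]; exists y => //=.
  - by rewrite -ot in yo.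
  - by rewrite (nextE cyc) // ot.
  - by rewrite -ot.
  - by rewrite (nextE cyc).
rewrite inE l2 /= => /andP [cyc Ut] ->.
pose s := perm (can_inj (prev_next Ut)).
have sE x : s x = next t x by rewrite permE.
have st x : (x \in supp s) = (x \in t).
  rewrite inE sE; apply/idP/idP => [| xt].
    by apply: contraR => xt; rewrite next_nth (negbTE xt).
  by have := next_cycle cyc xt; apply: contraTneq => ->; rewrite e_irr.
have fc : fcycle s t.
  by apply: (cycle_from_next Ut) => x xt; rewrite /= sE.
exists s.
  rewrite inE; apply/and3P; split.
  - by apply/along_edgesP => x; rewrite st sE => /(next_cycle cyc).
  - have t0 : (0 < size t)%N by rewrite size_tuple; lia.
    case E : (tval t) t0 => [|x q] // _.
    have xt : x \in t by rewrite -[x \in t]/(x \in tval t) E mem_head.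
    apply/imsetP; exists x => //; apply/setP => y.
    by rewrite st porbit_fconnect (fconnect_cycle fc xt).
  - by rewrite (eq_card st) (card_uniqP Ut) size_tuple.
apply/setP => S; apply/imsetP/imsetP => -[y yo ->]; exists y => //=.
- by rewrite st.
- by rewrite sE.
- by rewrite -st.
by rewrite sE.
Qed.

Lemma perm_edgesV s : perm_edges s^-1 = perm_edges s.
Proof.
apply/setP => S; apply/imsetP/imsetP => -[x xs ->].
  exists ((s^-1)%g x); last by rewrite permKV setUC.
  by rewrite -(suppV s) mem_supp_perm.
by exists (s x); [rewrite suppV mem_supp_perm | rewrite permK setUC].
Qed.

Lemma edge_cycleV l s : edge_cycle l s -> edge_cycle l s^-1.
Proof.
case/and3P => /along_edgesP sE so cs; apply/and3P; split.
- apply/along_edgesP => x xs; rewrite e_sym -{2}[x](permKV s).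
  by apply: sE; rewrite -(suppV s) mem_supp_perm.
- by rewrite porbitsV suppV.
by rewrite suppV.
Qed.

Lemma edge_cycle_no2 l s x : (2 < l)%N -> edge_cycle l s -> x \in supp s -> s (s x) != x.
Proof.
move=> l2 /and3P [_ so /eqP cs] xs; apply/negP => /eqP ssx.
have : (#|supp s| <= 2)%N.
  rewrite (porbit_in_porbits so xs); apply: leq_trans (_ : #|[set x; s x]| <= 2)%N.
    apply/subset_leq_card/subsetP => _ /porbitP [i ->]; rewrite permX.
    by elim: i => [|i]; rewrite /= !inE ?eqxx // => /orP [] /eqP ->;
       rewrite ?ssx eqxx ?orbT.
  by rewrite cards2; case: eqP.
by rewrite cs leqNgt l2.
Qed.

Lemma perm_edges_nbr s t x :
  perm_edges s = perm_edges t -> x \in supp s -> t x = s x \/ t x = (s^-1)%g x.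
Proof.
move=> E xs; have xt : x \in supp t by rewrite -cover_perm_edges -E cover_perm_edges.
have : [set x; t x] \in perm_edges s by rewrite E; apply: imset_f.
case/imsetP => y ys E2; have := set21 x (t x); rewrite E2 !inE => /orP [] /eqP xy.
  by left; apply: (@set2_eq _ x); rewrite E2 -xy.
by right; apply: (@set2_eq _ x); rewrite E2 xy permK setUC.
Qed.

(** At a common point [y] reached from a common predecessor, the other
    neighbour of [y] on the cycle is the only possible successor, because a
    cycle of length at least 3 does not turn back. *)
Lemma edge_cycle_agree l s t x : (2 < l)%N -> edge_cycle l s -> edge_cycle l t ->
  perm_edges s = perm_edges t -> x \in supp s -> t x = s x -> s = t.
Proof.
move=> l2 sC tC E xs txs.
have stE : supp s = supp t by rewrite -!cover_perm_edges E.
(* Along the orbit of [x], a disagreement would force [t] to turn back. *)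
have agree i : t ((s ^+ i)%g x) = s ((s ^+ i)%g x) /\ (s ^+ i)%g x \in supp s.
  elim: i => [|i [IH1 IH2]]; first by rewrite expg0 perm1.
  rewrite expgSr permM; set y := (s ^+ i)%g x in IH1 IH2 *; rewrite mem_supp_perm.
  split=> //; have sys : s y \in supp s by rewrite mem_supp_perm.
  have [-> //| E3] := perm_edges_nbr E sys.
  have := edge_cycle_no2 l2 tC (_ : y \in supp t); rewrite -stE => /(_ IH2).
  by rewrite IH1 E3 permK eqxx.
have /and3P [_ so _] := sC.
apply/permP => y; have [ys | ys] := boolP (y \in supp s); last first.
  by rewrite !fixed_out_supp // -stE.
move: ys; rewrite {1}(porbit_in_porbits so xs) => /porbitP [i ->].
by rewrite (agree i).1.
Qed.

Lemma edge_cycle_fibre l s t : (2 < l)%N -> edge_cycle l s -> edge_cycle l t ->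
  (perm_edges t == perm_edges s) = (t \in [set s; s^-1%g]).
Proof.
move=> l2 sC tC; rewrite !inE; apply/eqP/orP => [E | [] /eqP ->]; last exact: perm_edgesV.
  have /and3P [_ _ /eqP cs] := sC.
  have /set0Pn [x xs] : supp s != set0 by rewrite -card_gt0 cs; lia.
  have [txs | txs] := perm_edges_nbr (esym E) xs.
    by left; apply/eqP/esym; apply: (edge_cycle_agree l2 sC tC (esym E) xs).
  right; apply/eqP/esym; apply: (edge_cycle_agree l2 (edge_cycleV sC) tC _ _ txs).
    by rewrite perm_edgesV.
  by rewrite suppV.
by [].
Qed.

(** A cycle of the graph can be traversed in two directions, which differ
    because it has at least three vertices. *)
Lemma sum_edge_cycles (V : nmodType) (f : {set 'I_n} -> V) l : (2 < l)%N ->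
  \sum_(s | edge_cycle l s) f (supp s) = (\sum_(C in cycles e l) f (cover C)) *+ 2.
Proof.
move=> l2; rewrite -(perm_edges_cycles l2) -sumrMnl.
rewrite (eq_bigl (fun s => s \in [set s | edge_cycle l s])) => [|s]; last by rewrite inE.
rewrite (partition_big_imset perm_edges) /=; apply: eq_bigr => C /imsetP [s].
rewrite inE => sC ->; rewrite cover_perm_edges.
rewrite (eq_bigl (fun t => t \in [set s; s^-1%g])) => [|t]; last first.
  rewrite [t \in [set s0 | _]]inE; apply/andP/idP => [[tC] | ts].
    by rewrite (edge_cycle_fibre l2 sC tC).
  have tC : edge_cycle l t.
    by move: ts; rewrite !inE => /orP [] /eqP -> //; apply: edge_cycleV.
  by rewrite (edge_cycle_fibre l2 sC tC).
rewrite big_setU1 ?big_set1 ?suppV ?mulr2n // inE; apply/eqP => ss.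
have /and3P [_ _ /eqP cs] := sC.
have /set0Pn [x xs] : supp s != set0 by rewrite -card_gt0 cs; lia.
by have := edge_cycle_no2 l2 sC xs; rewrite {1}ss permK eqxx.
Qed.

End GraphCycles.

(** * Products of a three-cycle and a transposition *)

Section Mixed.

Variables (n : nat) (e : rel 'I_n).
Implicit Types (s t p : 'S_n) (x y : 'I_n).

Lemma supp_small s : supp s != set0 -> (#|supp s| <= 3)%N -> supp s \in porbits s.
Proof.
move=> s0 s3; apply: contraT => ns.
by have [|A [B [_ _ _ B2 E]]] := two_orbits s0 ns; [exact: leq_trans s3 _ | lia].
Qed.

Lemma single_order s : supp s \in porbits s -> (s ^+ #|supp s| = 1)%g.
Proof.
move=> so; apply/permP => x; rewrite perm1.
have [xs | xs] := boolP (x \in supp s); last by rewrite permX_fix // fixed_out_supp.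
by rewrite permX (porbit_in_porbits so xs) iter_porbit.
Qed.

Definition edge_mixed s :=
  [&& along_edges e s, supp s \notin porbits s & #|supp s| == 5%N].

(** The cycles have lengths 2 and 3: the fourth power kills the transposition
    and fixes the three-cycle, and the third power does the opposite. *)
Lemma edge_mixed_split s : edge_mixed s ->
  [/\ edge_cycle e 3 (s ^+ 4)%g, edge_involution e 1 (s ^+ 3)%g,
      [disjoint supp (s ^+ 4)%g & supp (s ^+ 3)%g] & (s ^+ 4 * s ^+ 3)%g = s].
Proof.
case/and3P => /along_edgesP sE ns /eqP s5.
have s0 : supp s != set0 by rewrite -card_gt0 s5.
have [|A [B [AB pE cA cB2 cE]]] := two_orbits s0 ns; first by rewrite s5.
have cB : #|B| = 3%N by lia.
have orb x : x \in supp s -> porbit s x = A \/ porbit s x = B.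
  move=> xs; have : porbit s x \in porbits_in s (supp s).
    by rewrite inE imset_f //= porbit_sub_supp.
  by rewrite pE !inE => /orP [] /eqP; auto.
have inO O x : O \in [set A; B] -> x \in O -> x \in supp s /\ porbit s x = O.
  rewrite -pE inE => /andP [Oo Os] xO; split; first exact: (subsetP Os).
  by rewrite -(porbit_in_porbits Oo xO).
have sA x : x \in A -> s (s x) = x.
  move=> xA; have [_ xO] := inO A x (set21 A B) xA.
  by apply: porbit_card2; rewrite xO.
have sB x : x \in B -> s (s (s x)) = x.
  move=> xB; have [_ xO] := inO B x (set22 A B) xB.
  by have := iter_porbit s x; rewrite xO cB.
(* On [A] the square of [s] is trivial, on [B] its cube. *)
have cases x : [\/ x \in A, x \in B | s x = x].
  have [xs | xs] := boolP (x \in supp s); last by constructor 3; apply: fixed_out_supp.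
  by have [E | E] := orb x xs; [constructor 1 | constructor 2]; rewrite -E porbit_id.
have p3 x : (s ^+ 3)%g x = s (s (s x)) by rewrite permX.
have p4 x : (s ^+ 4)%g x = s (s (s (s x))) by rewrite permX.
have S4 : supp (s ^+ 4)%g = B.
  apply/setP => x; rewrite inE p4; have [xA | xB | sx] := cases x.
  - rewrite !(sA x xA) eqxx; apply/esym/negbTE/negP => xB.
    have [_ EA] := inO A x (set21 A B) xA; have [_ EB] := inO B x (set22 A B) xB.
    by rewrite -EA -EB eqxx in AB.
  - by have [+ _] := inO B x (set22 A B) xB; rewrite (sB x xB) xB inE.
  rewrite !sx eqxx; apply/esym/negbTE/negP => xB.
  by have [+ _] := inO B x (set22 A B) xB; rewrite inE sx eqxx.
have S3 : supp (s ^+ 3)%g = A.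
  apply/setP => x; rewrite inE p3; have [xA | xB | sx] := cases x.
  - by have [+ _] := inO A x (set21 A B) xA; rewrite (sA x xA) xA inE.
  - rewrite (sB x xB) eqxx; apply/esym/negbTE/negP => xA.
    have [_ EA] := inO A x (set21 A B) xA; have [_ EB] := inO B x (set22 A B) xB.
    by rewrite -EA -EB eqxx in AB.
  rewrite !sx eqxx; apply/esym/negbTE/negP => xA.
  by have [+ _] := inO A x (set21 A B) xA; rewrite inE sx eqxx.
split.
- apply/and3P; split; last by rewrite S4 cB.
    apply/along_edgesP => x; rewrite S4 => xB; rewrite p4 (sB x xB).
    by apply: sE; have [] := inO B x (set22 A B) xB.
  by apply: supp_small; rewrite -?card_gt0 S4 cB.
- apply/and3P; split; last by rewrite S3 cA.
    apply/along_edgesP => x; rewrite S3 => xA; rewrite p3 (sA x xA).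
    by apply: sE; have [] := inO A x (set21 A B) xA.
  apply/eqP/permP => x; rewrite permM perm1 !p3.
  by have [xA | xB | sx] := cases x; [rewrite !(sA x xA) | rewrite !(sB x xB) | rewrite !sx].
- rewrite S4 S3; apply/pred0P => x /=; apply/negP => /andP [xB xA].
  have [_ EA] := inO A x (set21 A B) xA; have [_ EB] := inO B x (set22 A B) xB.
  by rewrite -EA -EB eqxx in AB.
apply/permP => x; rewrite permM p3 p4.
have [xA | xB | sx] := cases x; last by rewrite !sx.
  by rewrite !(sA x xA).
by rewrite !(sB x xB).
Qed.

Lemma edge_mixed_join s t : edge_cycle e 3 s -> edge_involution e 1 t ->
  [disjoint supp s & supp t] ->
  [/\ edge_mixed (s * t)%g, ((s * t) ^+ 4)%g = s & ((s * t) ^+ 3)%g = t].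
Proof.
move=> /and3P [/along_edgesP sE so /eqP cs] /and3P [/along_edgesP tE tt /eqP ct] dst.
have com : commute s t by apply: (perm_onC (perm_on_supp s) (perm_on_supp t)).
have s3 : (s ^+ 3 = 1)%g by have := single_order so; rewrite cs.
have t2 : (t ^+ 2 = 1)%g by rewrite expgS expg1; apply/eqP.
have us x : x \in supp s -> (s * t)%g x = s x.
  by move=> xs; rewrite permM fixed_out_supp // (disjointFr dst) // mem_supp_perm.
have ut x : x \in supp t -> (s * t)%g x = t x.
  by move=> xt; rewrite permM (@fixed_out_supp _ s x) // (disjointFl dst).
have S : supp (s * t)%g = supp s :|: supp t.
  apply/setP => x; rewrite in_setU; have [xs | xs] := boolP (x \in supp s).
    by rewrite inE us //; move: xs; rewrite inE.
  have [xt | xt] := boolP (x \in supp t).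
    by rewrite inE ut //; move: xt; rewrite inE.
  by rewrite inE permM !(fixed_out_supp xs, fixed_out_supp xt) eqxx.
split.
- apply/and3P; split; last by rewrite S cards_disjointU // cs ct.
    apply/along_edgesP => x; rewrite S in_setU => /orP [xs | xt].
      by rewrite us // sE.
    by rewrite ut // tE.
  apply/negP => so2.
  have /set0Pn [x xs] : supp s != set0 by rewrite -card_gt0 cs.
  have /set0Pn [y yt] : supp t != set0 by rewrite -card_gt0 ct.
  have inv : (s * t)%g @: supp s = supp s by rewrite (eq_in_imset us) supp_inv.
  have xst : x \in supp (s * t)%g by rewrite S in_setU xs.
  have : supp (s * t)%g \subset supp s.
    by rewrite (porbit_in_porbits so2 xst) porbit_sub_inv.
  move/subsetP/(_ y); rewrite S in_setU yt orbT => /(_ isT) ys.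
  by rewrite (disjointFr dst ys) in yt.
- by rewrite expgMn // (expgS s 3) s3 mulg1 (expgM t 2 2) t2 expg1n mulg1.
by rewrite expgMn // s3 mul1g expgS t2 mulg1.
Qed.

(** The two powers and the product are inverse bijections. *)
Lemma card_edge_mixed :
  (\sum_(s | edge_mixed s) 1 =
   \sum_(s | edge_cycle e 3 s) \sum_(t | edge_involution e 1 t)
     [disjoint supp s & supp t])%N.
Proof.
have -> : (\sum_(s | edge_cycle e 3 s) \sum_(t | edge_involution e 1 t)
     [disjoint supp s & supp t] =
   \sum_(s | edge_cycle e 3 s)
     \sum_(t | edge_involution e 1 t && [disjoint supp s & supp t]) 1)%N.
  by apply: eq_bigr => s _; rewrite [RHS]big_mkcondr; apply: eq_bigr => t _; case: ifP.
rewrite pair_big_dep /= (reindex_onto (fun p : 'S_n * 'S_n => p.1 * p.2)%g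
  (fun s => (s ^+ 4, s ^+ 3))%g) /= => [|s /edge_mixed_split [] //].
apply: eq_bigl => -[s t] /=; apply/andP/and3P => [[M /eqP [E4 E3]] | [sC tI d]].
  by have [] := edge_mixed_split M; rewrite E4 E3.
by have [-> -> ->] := edge_mixed_join sC tI d; rewrite eqxx.
Qed.

End Mixed.

(** * Counting edges *)

Section EdgeCounts.

Variables (n : nat) (e : rel 'I_n).
Hypotheses (e_sym : symmetric e) (e_irr : irreflexive e).
Implicit Types (S : {set 'I_n}) (v : 'I_n).

Lemma deg_edges v : deg e v = #|[set E in edges e | v \in E]|.
Proof.
rewrite /deg -(card_in_imset (f := fun w => [set v; w])); last first.
  by move=> w w' _ _; apply: set2_eq.
apply: eq_card => E; rewrite inE; apply/imsetP/andP => [[w] | [/edgesP [a [b [eab ->]]]]].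
  rewrite inE => evw ->; split; last exact: set21.
  by apply/edgesP; exists v, w.
rewrite !inE => /orP [] /eqP ->; first by exists b; rewrite ?inE.
by exists a; rewrite ?inE 1?e_sym // setUC.
Qed.

Lemma sum_deg S : (\sum_(v in S) deg e v = \sum_(E in edges e) #|E :&: S|)%N.
Proof.
under eq_bigr => v _ do rewrite deg_edges -sum1_card.
under [RHS]eq_bigr => E _ do rewrite -sum1_card.
rewrite (exchange_big_dep (mem (edges e))) /=; last by move=> v E _; rewrite inE => /andP [].
apply: eq_bigr => E EE; apply: eq_bigl => v.
by rewrite in_setI inE EE andbC.
Qed.

Lemma handshake : (\sum_v deg e v = 2 * #|edges e|)%N.
Proof.
transitivity (\sum_(E in edges e) #|E :&: [set: 'I_n]|)%N.
  by rewrite -sum_deg; apply: eq_bigl => v; rewrite inE.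
rewrite mulnC -sum_nat_const; apply: eq_bigr => E EE.
by rewrite setIT (card_edge e_irr).
Qed.

Lemma sum_matchings1 (V : nmodType) (f : {set 'I_n} -> V) :
  \sum_(M in matchings e 1) f (cover M) = \sum_(E in edges e) f E.
Proof.
have -> : matchings e 1 = set1 @: edges e.
  apply/setP => M; rewrite inE; apply/and3P/imsetP => [[ME _ /cards1P [E ME']] | [E EE ->]].
    by exists E => //; move: ME; rewrite ME' sub1set.
  by rewrite sub1set EE trivIset1 cards1.
by rewrite big_imset /= => [|E E' _ _ /set1_inj //]; apply: eq_bigr => E _; rewrite cover1.
Qed.

Lemma card_matchings1 : #|matchings e 1| = #|edges e|.
Proof. by rewrite -!sum1_card; apply: (sum_matchings1 (fun=> 1%N)). Qed.

(** Two distinct edges either are disjoint or share exactly one vertex, and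
    the pairs of edges that share the vertex [v] are counted by its degree. *)
Lemma card_matchings2 :
  (#|matchings e 2| + \sum_(v < n) 'C(deg e v, 2) = 'C(#|edges e|, 2))%N.
Proof.
(* The sum over [v] counts the common vertices of the two edges in [P]. *)
have C2 (P : {set {set 'I_n}}) : P \subset edges e -> #|P| = 2%N ->
    (trivIset P + \sum_(v < n) (P \subset [set E in edges e | v \in E]) = 1)%N.
  move=> PE /eqP /cards2P [E1 [E2 [nE eP]]].
  have [E1E E2E] : E1 \in edges e /\ E2 \in edges e.
    by split; apply: (subsetP PE); rewrite eP !inE eqxx ?orbT.
  have -> : (\sum_(v < n) (P \subset [set E in edges e | v \in E]) = #|E1 :&: E2|)%N.
    rewrite -sum1_card [RHS]big_mkcond; apply: eq_bigr => v _.
    by rewrite eP subUset !sub1set [E1 \in _]inE [E2 \in _]inE E1E E2E /= inE; case: andb.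
  have c1 := card_edge e_irr E1E; have c2 := card_edge e_irr E2E.
  have lt : (#|E1 :&: E2| < 2)%N.
    rewrite ltnNge; apply: contra nE => I2.
    have S1 : E1 :&: E2 == E1 by rewrite eqEcard subsetIl c1.
    have S2 : E1 :&: E2 == E2 by rewrite eqEcard subsetIr c2.
    by rewrite -(eqP S1) (eqP S2).
  have -> : trivIset P = [disjoint E1 & E2].
    rewrite eP; apply/trivIsetP/idP => [H | d A B]; first by apply: H; rewrite ?inE ?eqxx ?orbT.
    rewrite !inE => /orP [] /eqP -> /orP [] /eqP ->; rewrite ?eqxx // => _.
    by rewrite disjoint_sym.
  by rewrite -setI_eq0 -cards_eq0; case: #|_| lt => [|[]].
rewrite -(cards_draws (edges e) 2) -sum1_card.
transitivity (\sum_(P in [set P : {set {set 'I_n}} | (P \subset edges e) && (#|P| == 2%N)])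
   (trivIset P + \sum_(v < n) (P \subset [set E in edges e | v \in E])))%N; last first.
  rewrite -[RHS]sum1_card; apply: eq_big => [P | P]; first by rewrite !inE.
  by rewrite inE => /andP [PE /eqP P2]; rewrite C2.
rewrite big_split /=; congr (_ + _)%N.
  rewrite [RHS]big_mkcond [LHS]big_mkcond; apply: eq_bigr => P _; rewrite !inE.
  by case: (P \subset _); case: (trivIset P); case: (_ == _).
rewrite exchange_big; apply: eq_bigr => v _.
rewrite deg_edges -cards_draws -sum1_card big_mkcond [RHS]big_mkcond.
apply: eq_bigr => P _; rewrite !inE.
have [sP | nP] := boolP (P \subset [set E in edges e | v \in E]) => /=; last by case: ifP.
have -> : P \subset edges e.
  by apply: subset_trans sP _; apply/subsetP => E; rewrite inE => /andP [].
by [].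
Qed.

(** Any two of the three vertices are adjacent. *)
Lemma edges_in_triangle s : edge_cycle e 3 s ->
  #|[set E in edges e | E \subset supp s]| = 3%N.
Proof.
case/and3P => /along_edgesP sE so /eqP cs.
have s3 : (s ^+ 3 = 1)%g by have := single_order so; rewrite cs.
transitivity 'C(#|supp s|, 2); last by rewrite cs.
rewrite -cards_draws; apply: eq_card => E; rewrite !inE.
have [/= Es|] := boolP (E \subset supp s); rewrite ?andbF // andbT.
apply/idP/eqP => [EE | /eqP /cards2P [a [b [ab eE]]]].
  by apply: (card_edge e_irr); rewrite inE.
have [as_ bs] : a \in supp s /\ b \in supp s.
  by split; apply: (subsetP Es); rewrite eE !inE eqxx ?orbT.
have eab : e a b.
  have sss x : s (s (s x)) = x by rewrite -[RHS](perm1 x) -s3 permX.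
  have : b \in porbit s a by rewrite -(porbit_in_porbits so as_).
  case/porbitP => i; rewrite permX; move: ab.
  have [j [j3 ->]] : exists j, (j < 3)%N /\ iter i s a = iter j s a.
    elim: i => [|i [j [j3 IH]]]; first by exists 0%N.
    case: j j3 IH => [|[|[|//]]] _ IH; rewrite [iter i.+1 s a]/= IH /=.
    - by exists 1%N.
    - by exists 2%N.
    by exists 0%N; rewrite sss.
  case: j j3 => [|[|[|//]]] _ /= ab eb; first by rewrite eb eqxx in ab.
    by rewrite eb sE.
  by rewrite eb e_sym -{2}[a]sss sE // mem_supp_perm mem_supp_perm.
by have : E \in edges e; [apply/edgesP; exists a, b | rewrite inE].
Qed.

(** An edge with [i] ends on the triangle is counted [i] times by the degrees;
    the three edges with both ends there are counted once too often. *)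
Lemma card_edges_off_triangle s : edge_cycle e 3 s ->
  (\sum_(E in edges e) [disjoint supp s & E] + \sum_(v in supp s) deg e v =
   #|edges e| + 3)%N.
Proof.
move=> sC; rewrite sum_deg -(edges_in_triangle sC) -!sum1_card -big_split /=.
rewrite [X in (_ + X)%N](eq_bigl (fun E => (E \in edges e) && (E \subset supp s))); last first.
  by move=> E; rewrite inE.
rewrite big_mkcondr -big_split /=; apply: eq_bigr => E EE.
have c2 := card_edge e_irr EE.
rewrite disjoint_sym -setI_eq0 -cards_eq0.
have -> : (E \subset supp s) = (#|E :&: supp s| == 2%N).
  apply/idP/eqP => [/setIidPl -> // | c].
  by apply/setIidPl/eqP; rewrite eqEcard subsetIl c c2.
have : (#|E :&: supp s| <= 2)%N by rewrite -c2 subset_leq_card // subsetIl.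
by case: #|_| => [|[|[|]]].
Qed.

End EdgeCounts.

(** * The coefficients, one support size at a time *)

Section Strata.

Variables (R : numFieldType) (n k : nat) (e : rel 'I_n).
Hypotheses (e_sym : symmetric e) (e_irr : irreflexive e) (kn : (0 < k <= n)%N).
Let K := k%:Z.
Let chi := @specht_char R n (hook n k).

(** The part of a coefficient that comes from permutations moving [u] points,
    with the factor that depends only on the moved set left as [f]. *)
Definition stratum (u : nat) (f : {set 'I_n} -> R) : R :=
  \sum_(s : 'S_n | along_edges e s && (#|supp s| == u)) chi s * f (supp s).

Lemma stratum0 f : stratum 0 f = binz (n - 1) (K - 1) * f set0.
Proof.
rewrite /stratum (big_pred1 1%g) => [|s].
  rewrite [chi _]hook_value1 //; congr (_ * f _).
  by apply/setP => x; rewrite !inE perm1 eqxx.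
rewrite /= cards_eq0; apply/andP/eqP => [[_ /eqP s0] | ->].
  by apply/permP => x; rewrite perm1 fixed_out_supp // s0 inE.
split; first by apply/along_edgesP => x; rewrite inE perm1 eqxx.
by apply/eqP/setP => x; rewrite !inE perm1 eqxx.
Qed.

Lemma stratum1 f : stratum 1 f = 0.
Proof.
apply: big1 => s /andP [_ /eqP s1].
have /set0Pn [x xs] : supp s != set0 by rewrite -card_gt0 s1.
have := card_porbit_supp xs; rewrite leqNgt.
have := subset_leq_card (etrans (porbit_sub_supp s x) xs).
by rewrite s1 -ltnS => ->.
Qed.

Lemma stratum_single u f : (u < n)%N ->
  \sum_(s | (along_edges e s && (#|supp s| == u)) && (supp s \in porbits s))
     chi s * f (supp s) =
  (binz (n - u.+1) (K - u.+1%:Z) - (-1) ^+ u * binz (n - u.+1) (K - 1)) *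
  \sum_(s | edge_cycle e u s) f (supp s).
Proof.
move=> un; rewrite mulr_sumr; apply: eq_big => [s | s].
  by rewrite /edge_cycle -andbA [(_ == u) && _]andbC.
by case/andP => /andP [_ /eqP cs] so; rewrite [chi s](hook_value_single R kn cs un so).
Qed.

Lemma stratum_small u f : (0 < u < n)%N -> (u <= 3)%N -> stratum u f =
  (binz (n - u.+1) (K - u.+1%:Z) - (-1) ^+ u * binz (n - u.+1) (K - 1)) *
  \sum_(s | edge_cycle e u s) f (supp s).
Proof.
case/andP => u0 un u3; rewrite -(stratum_single f un); apply: eq_bigl => s.
have [cs|] := eqVneq #|supp s| u; rewrite ?andbF // andbT.
by rewrite supp_small ?andbT // -?card_gt0 cs.
Qed.

Lemma stratum2 f : (2 < n)%N -> stratum 2 f =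
  (binz (n - 3) (K - 3) - binz (n - 3) (K - 1)) *
  \sum_(M in matchings e 1) f (cover M).
Proof.
move=> n2; rewrite stratum_small // -(sum_involutions e_sym e_irr) expr2 mulN1r opprK.
rewrite mul1r; congr (_ * _); apply: eq_bigl => s.
apply/and3P/and3P => [[sE so cs] | [sE ss cs]]; split=> //.
  by have := single_order so; rewrite (eqP cs) expgS expg1 => ->.
by rewrite supp_small // -?card_gt0 (eqP cs).
Qed.

Lemma stratum3 f : (3 < n)%N -> stratum 3 f =
  (binz (n - 4) (K - 4) + binz (n - 4) (K - 1)) *
  ((\sum_(C in cycles e 3) f (cover C)) *+ 2).
Proof.
move=> n3; rewrite stratum_small // (sum_edge_cycles e_sym e_irr) //.
by congr (_ * _); ring.
Qed.

Lemma edge_involution2 s :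
  edge_involution e 2 s =
  (along_edges e s && (#|supp s| == 4%N)) && (supp s \notin porbits s).
Proof.
apply/and3P/andP => [[sE ss cs] | [/andP [sE cs] ns]].
  split; first by rewrite sE.
  apply/negP => so; have /set0Pn [x xs] : supp s != set0 by rewrite -card_gt0 (eqP cs).
  have sC : edge_cycle e 4 s by apply/and3P.
  by have := edge_cycle_no2 (isT : 2 < 4)%N sC xs; rewrite involutionK ?eqxx.
split=> //; have s0 : supp s != set0 by rewrite -card_gt0 (eqP cs).
have [|A [B [AB pE cA cB2 cE]]] := two_orbits s0 ns; first by rewrite (eqP cs).
have cB : #|B| = 2%N by move: cs; rewrite cE => /eqP [].
apply/eqP/permP => x; rewrite permM perm1.
have [xs | /fixed_out_supp sx] := boolP (x \in supp s); last by rewrite !sx.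
have : porbit s x \in porbits_in s (supp s) by rewrite inE imset_f //= porbit_sub_supp.
by rewrite pE !inE => /orP [] /eqP E; apply: porbit_card2; rewrite E.
Qed.

Lemma stratum4 f : (4 < n)%N -> stratum 4 f =
  (binz (n - 5) (K - 5) - binz (n - 5) (K - 1)) *
    ((\sum_(C in cycles e 4) f (cover C)) *+ 2) +
  (binz (n - 5) (K - 5) - 2 * binz (n - 5) (K - 3) + binz (n - 5) (K - 1)) *
    \sum_(M in matchings e 2) f (cover M).
Proof.
move=> n4; rewrite /stratum (bigID (fun s => supp s \in porbits s)) /=; congr (_ + _).
  rewrite stratum_single // (sum_edge_cycles e_sym e_irr) //.
  by congr (_ * _); ring.
rewrite -(sum_involutions e_sym e_irr) mulr_sumr.
apply: eq_big => [s | s]; first by rewrite edge_involution2.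
case/andP => /andP [_ /eqP cs] ns; have s0 : supp s != set0 by rewrite -card_gt0 cs.
have [|A [B [AB pE cA cB2 cE]]] := two_orbits s0 ns; first by rewrite cs.
have cB : #|B| = 2%N by apply: (@addnI 2); rewrite -cE cs.
congr (_ * _); rewrite [chi s](hook_value_pair R kn AB pE cA cB) //=.
by rewrite -/K; ring.
Qed.

Lemma stratum5 : (5 < n)%N -> stratum 5 (fun=> 1) =
  (binz (n - 6) (K - 6) + binz (n - 6) (K - 1)) * (2 * #|cycles e 5|%:R) +
  (binz (n - 6) (K - 6) + binz (n - 6) (K - 3)
     - binz (n - 6) (K - 4) - binz (n - 6) (K - 1)) *
  \sum_(C in cycles e 3) 2 * (#|edges e|%:R + 3 - (deg_sum e C)%:R).
Proof.
move=> n5; rewrite /stratum (bigID (fun s => supp s \in porbits s)) /=; congr (_ + _).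
  rewrite (stratum_single (fun=> 1) n5) (sum_edge_cycles e_sym e_irr (fun=> 1)) // sumr_const.
  by rewrite -mulrnA mulnC natrM; congr (_ * _); ring.
have mixedE s : edge_mixed e s =
    (along_edges e s && (#|supp s| == 5%N)) && (supp s \notin porbits s).
  by rewrite /edge_mixed -andbA [(_ == _) && _]andbC.
have val s : edge_mixed e s -> chi s * 1 = binz (n - 6) (K - 6) + binz (n - 6) (K - 3)
     - binz (n - 6) (K - 4) - binz (n - 6) (K - 1).
  case/and3P => _ ns /eqP cs; have s0 : supp s != set0 by rewrite -card_gt0 cs.
  have [|A [B [AB pE cA cB2 cE]]] := two_orbits s0 ns; first by rewrite cs.
  have cB : #|B| = 3%N by apply: (@addnI 2); rewrite -cE cs.
  rewrite mulr1 [chi s](hook_value_pair R kn AB pE cA cB) //=.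
  by rewrite -/K; ring.
rewrite -(eq_bigl _ _ mixedE) (eq_bigr _ val) sumr_const -sum1_card.
rewrite -[LHS]mulr_natr; congr (_ * _).
rewrite (eq_bigl (edge_mixed e)) // card_edge_mixed.
have -> : (\sum_(s | edge_cycle e 3 s) \sum_(t | edge_involution e 1 t)
     [disjoint supp s & supp t] =
   \sum_(s | edge_cycle e 3 s) \sum_(E in edges e) [disjoint supp s & E])%N.
  apply: eq_bigr => s _.
  rewrite (sum_involutions e_sym e_irr (fun S => [disjoint supp s & S] : nat)).
  exact: (sum_matchings1 e (fun S => [disjoint supp s & S] : nat)).
rewrite natr_sum.
rewrite (eq_bigr (fun s => #|edges e|%:R + 3 - (\sum_(v in supp s) deg e v)%N%:R)).
  rewrite (sum_edge_cycles e_sym e_irr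
    (fun S => #|edges e|%:R + 3 - (\sum_(v in S) deg e v)%N%:R)) //.
  by rewrite -mulr_sumr mulr_natl.
move=> s sC; apply/eqP; rewrite eq_sym subr_eq -!natrD.
by rewrite (card_edges_off_triangle e_sym e_irr sC).
Qed.

End Strata.

Lemma esym_deg0 n (e : rel 'I_n) A : esym_deg e 0 A = 1%N.
Proof.
rewrite /esym_deg (big_pred1 set0) ?big_set0 // => B /=.
by rewrite cards_eq0 andbC; case: eqP => // ->; rewrite sub0set.
Qed.

Lemma esym_deg1 n (e : rel 'I_n) A : esym_deg e 1 A = (\sum_(v in A) deg e v)%N.
Proof.
rewrite /esym_deg (eq_bigl (fun B => B \in set1 @: A)) => [|B].
  rewrite big_imset /= => [|x y _ _ /set1_inj //].
  by apply: eq_bigr => v _; rewrite big_set1.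
apply/andP/imsetP => [[BA /cards1P [v E]] | [v vA ->]].
  by exists v => //; move: BA; rewrite E sub1set.
by rewrite sub1set cards1.
Qed.

Lemma imm_coef_strata (R : numFieldType) n (k : nat) (e : rel 'I_n)
    (beta gamma : R) r : irreflexive e -> (r <= n)%N ->
  imm_coef (hook n k) (beta *: deg_mx e R + gamma *: adj_mx e R) r =
  \sum_(u < r.+1) gamma ^+ u * beta ^+ (r - u) *
    stratum k e u (fun S => (esym_deg e (r - u) (~: S))%:R).
Proof. by move=> e_irr rn; rewrite imm_coef_graph. Qed.
Theorem theorem4p3 (R : realType) (n k : nat) (e : rel 'I_n) (beta gamma : R)
    (e_sym : symmetric e) (e_irr : irreflexive e) (k_gt0 : (1 <= k)%N)
    (k_le_n : (k <= n)%N) :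
  let m := #|edges e| in
  let F r : R := (esym_deg e r [set: 'I_n])%:R in
  let Cyc r l : R := (cyc_sum e l r)%:R in
  let Mat r l : R := (match_sum e l r)%:R in
  let K := k%:Z in
  let c := imm_coef (hook n k) (beta *: deg_mx e R + gamma *: adj_mx e R) in
  let q : R := 2 * k%:R - n%:R - 1 in
  [/\ c 0%N = binz (n - 1) (K - 1),
      c 1%N = beta * F 1%N * binz (n - 1) (K - 1) /\
      c 1%N = 2 * m%:R * beta * binz (n - 1) (K - 1)
    & (2 <= k)%N ->
      [/\ (3 <= n)%N ->
          c 2%N = beta ^+ 2 * F 2%N * binz (n - 1) (K - 1)
            + q * m%:R * gamma ^+ 2 / (k%:R - 1) * binz (n - 2) (K - 2),
          (4 <= n)%N ->
          c 3%N = beta ^+ 3 * F 3%N * binz (n - 1) (K - 1)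
            + q * beta * gamma ^+ 2 * Mat 3%N 1%N / (k%:R - 1) * binz (n - 2) (K - 2)
            + 2 * #|cycles e 3|%:R * gamma ^+ 3
                * (binz (n - 4) (K - 4) + binz (n - 4) (K - 1)),
          (5 <= n)%N ->
          c 4%N = beta ^+ 4 * F 4%N * binz (n - 1) (K - 1)
            + q * beta ^+ 2 * gamma ^+ 2 * Mat 4%N 1%N / (k%:R - 1)
                * binz (n - 2) (K - 2)
            + 2 * beta * gamma ^+ 3 * Cyc 4%N 3%N
                * (binz (n - 4) (K - 4) + binz (n - 4) (K - 1))
            + 2 * #|cycles e 4|%:R * gamma ^+ 4
                * (binz (n - 5) (K - 5) - binz (n - 5) (K - 1))
            + ('C(m, 2)%:R - \sum_(i < n) 'C(deg e i, 2)%:R)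
                * (binz (n - 5) (K - 5) - 2 * binz (n - 5) (K - 3) + binz (n - 5) (K - 1))
                * gamma ^+ 4
        & (6 <= n)%N ->
          c 5%N = beta ^+ 5 * F 5%N * binz (n - 1) (K - 1)
            + q * beta ^+ 3 * gamma ^+ 2 * Mat 5%N 1%N / (k%:R - 1)
                * binz (n - 2) (K - 2)
            + 2 * beta ^+ 2 * gamma ^+ 3 * Cyc 5%N 3%N
                * (binz (n - 4) (K - 4) + binz (n - 4) (K - 1))
            + 2 * beta * gamma ^+ 4 * Cyc 5%N 4%N
                * (binz (n - 5) (K - 5) - binz (n - 5) (K - 1))
            + beta * gamma ^+ 4 * Mat 5%N 2%N
                * (binz (n - 5) (K - 5) - 2 * binz (n - 5) (K - 3) + binz (n - 5) (K - 1))
            + 2 * #|cycles e 5|%:R * gamma ^+ 5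
                * (binz (n - 6) (K - 6) + binz (n - 6) (K - 1))
            + \sum_(C in cycles e 3)
                2 * (m%:R + 3 - (deg_sum e C)%:R) * gamma ^+ 5
                * (binz (n - 6) (K - 6) + binz (n - 6) (K - 3)
                   - binz (n - 6) (K - 4) - binz (n - 6) (K - 1))]].
Proof.
have kn : (0 < k <= n)%N by rewrite k_gt0.
move=> m F Cyc Mat K c q.
pose f r u (S : {set 'I_n}) : R := (esym_deg e (r - u) (~: S))%:R.
have cE r : (r <= n)%N ->
    c r = \sum_(u < r.+1) gamma ^+ u * beta ^+ (r - u) * stratum k e u (f r u).
  exact: imm_coef_strata.
have S0 r : stratum k e 0 (f r 0%N) = binz (n - 1) (K - 1) * F r.
  by rewrite stratum0 // /f setC0 subn0.
have S1 r : stratum k e 1 (f r 1%N) = 0 by rewrite stratum1.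
have F1 : F 1%N = 2 * m%:R.
  rewrite /F esym_deg1 -natrM -(handshake e_sym e_irr); congr (_%:R).
  by apply: eq_bigl => v; rewrite inE.
have c1 : c 1%N = beta * F 1%N * binz (n - 1) (K - 1).
  rewrite cE ?(leq_trans k_gt0) // !big_ord_recr big_ord0 /= S0 S1; ring.
split.
- by rewrite cE // big_ord_recr big_ord0 /= S0 /F esym_deg0; ring.
- by split; rewrite c1 // F1; ring.
move=> k2.
have S2 r : (2 < n)%N -> stratum k e 2 (f r 2%N) =
    q / (k%:R - 1) * binz (n - 2) (K - 2) * Mat r 1%N.
  move=> n2; rewrite stratum2 // (binz_transposition R kn k2 n2).
  by rewrite /Mat /match_sum natr_sum.
have S3 r : (3 < n)%N -> stratum k e 3 (f r 3%N) =
    (binz (n - 4) (K - 4) + binz (n - 4) (K - 1)) * (2 * Cyc r 3%N).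
  by move=> n3; rewrite stratum3 // /Cyc /cyc_sum natr_sum mulr_natl.
have S4 r : (4 < n)%N -> stratum k e 4 (f r 4%N) =
    (binz (n - 5) (K - 5) - binz (n - 5) (K - 1)) * (2 * Cyc r 4%N) +
    (binz (n - 5) (K - 5) - 2 * binz (n - 5) (K - 3) + binz (n - 5) (K - 1)) *
      Mat r 2%N.
  move=> n4; rewrite stratum4 // /Cyc /cyc_sum /Mat /match_sum !natr_sum.
  by rewrite [2 * (\sum_(C in cycles e 4) _)]mulr_natl.
have Mat2 : Mat 2%N 1%N = m%:R.
  rewrite /Mat /match_sum (eq_bigr (fun=> 1%N)) => [|M _]; last by rewrite esym_deg0.
  by rewrite sum1_card card_matchings1.
have Mat4 : Mat 4%N 2%N = 'C(m, 2)%:R - \sum_(i < n) 'C(deg e i, 2)%:R.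
  rewrite /Mat /match_sum (eq_bigr (fun=> 1%N)) => [|M _]; last by rewrite esym_deg0.
  by rewrite sum1_card -natr_sum -(card_matchings2 e_sym e_irr) natrD addrK.
have CycD l : Cyc l l = #|cycles e l|%:R.
  rewrite /Cyc /cyc_sum subnn (eq_bigr (fun=> 1%N)) => [|C _]; last by rewrite esym_deg0.
  by rewrite sum1_card.
split=> n_gt; rewrite cE ?(leq_trans _ n_gt) // !big_ord_recr big_ord0 /= S0 S1.
- by rewrite S2 // Mat2; ring.
- by rewrite S2 ?S3 ?CycD ?(ltnW n_gt) //; ring.
- by rewrite S2 ?S3 ?S4 ?CycD ?Mat4 //; try lia; ring.
rewrite S2 ?S3 ?S4; try lia.
have -> : stratum k e 5 (f 5%N 5%N) = stratum k e 5 (fun=> 1) :> R.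
  by apply: eq_bigr => s _; rewrite /f esym_deg0.
rewrite stratum5 //.
have -> : \sum_(C in cycles e 3) 2 * (m%:R + 3 - (deg_sum e C)%:R) * gamma ^+ 5 *
      (binz (n - 6) (K - 6) + binz (n - 6) (K - 3) -
       binz (n - 6) (K - 4) - binz (n - 6) (K - 1)) =
    gamma ^+ 5 * ((binz (n - 6) (K - 6) + binz (n - 6) (K - 3) -
       binz (n - 6) (K - 4) - binz (n - 6) (K - 1)) *
    \sum_(C in cycles e 3) 2 * (m%:R + 3 - (deg_sum e C)%:R)) :> R.
  by rewrite mulrA mulr_sumr; apply: eq_bigr => C _; ring.
ring.
Qed.
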